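(* Let $A$ be an arbitrary (bounded or unbounded) scalar type spectral operator in a complex Banach space $(X,\|\cdot\|)$ with spectral measure $E_A(\cdot)$. Then $A$ is non-hypercyclic, i.e., there is no nonzero vector $f\in C^\infty(A):=\bigcap_{n=0}^\infty D(A^n)$ whose orbit $\{A^nf\}_{n\in\mathbb{Z}_+}$ is dense in $X$. Moreover, the collection $\{e^{tA}\}_{t\ge 0}$ of its exponentials is non-hypercyclic, i.e., there is no nonzero vector $f\in\bigcap_{t\ge 0}D(e^{tA})$ whose orbit $\{e^{tA}f\}_{t\ge 0}$ is dense in $X$; here, provided the spectrum $\sigma(A)$ is contained in a left half-plane $\{\lambda\in\mathbb{C}\mid \operatorname{Re}\lambda\le\omega\}$ with some $\omega\in\mathbb{R}$, the collection $\{e^{tA}\}_{t\ge 0}$ coincides with the $C_0$-semigroup generated by $A$.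
   Context: $\mathbb{Z}_+=\{0,1,2,\dots\}$; $A^0:=I$ is the identity operator on $X$; $D(\cdot)$ denotes the domain of an operator. Hypercyclicity. A linear operator $A:X\supseteq D(A)\to X$ in a Banach space is hypercyclic if there is a nonzero $f\in\bigcap_{n=0}^\infty D(A^n)$ whose orbit $\{A^nf\}_{n\in\mathbb{Z}_+}$ is dense in $X$. A collection $\{T(t)\}_{t\in J}$ ($J$ a nonempty index set) of linear operators in $X$ is hypercyclic if there is a nonzero $f\in\bigcap_{t\in J}D(T(t))$ whose orbit $\{T(t)f\}_{t\in J}$ is dense in $X$. Non-hypercyclic means not hypercyclic. Scalar type spectral operators (in the sense of Dunford). A spectral measure $E$ on $X$ is a map from the Borel subsets of $\mathbb{C}$ to bounded linear projections on $X$ with $E(\emptyset)=0$, $E(\mathbb{C})=I$, $E(\delta\cap\sigma)=E(\delta)E(\sigma)$ for all Borel sets $\delta,\sigma$, and countably additive in the strong operator topology. For a bounded Borel function $F$, $\int F\,dE$ is the bounded operator obtained as the operator-norm limit of integrals of simple functions converging uniformly to $F$. For an arbitrary Borel function $F$, put $F_n:=F\cdot\chi_{\{|F|\le n\}}$ ($\chi_\delta$ is the characteristic function of the set $\delta$), and let $\int F\,dE$ be the operator with domain $\{f\in X\mid \lim_{n\to\infty}\int F_n\,dE\,f \text{ exists in } X\}$ whose value at such an $f$ is this limit. An operator $A$ in $X$ is a scalar type spectral operator if there is a spectral measure $E=E_A$ (its spectral measure, or resolution of the identity) such that $A=\int\lambda\,dE_A(\lambda)$, with equality of domains; the support of $E_A$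 is the spectrum $\sigma(A)$. For a Borel measurable function $F:\sigma(A)\to\mathbb{C}$, one defines $F(A):=\int_{\sigma(A)}F(\lambda)\,dE_A(\lambda)$; in particular, $e^{tA}:=\int_{\sigma(A)}e^{t\lambda}\,dE_A(\lambda)$ for $t\in\mathbb{R}$, in general an unbounded operator. *)

(* Defs.v *)
From HB Require Import structures.
From mathcomp Require Import all_boot all_order all_algebra.
From mathcomp Require Import complex.
From mathcomp Require Import all_classical all_reals all_analysis.
Set Implicit Arguments.
Unset Strict Implicit.
Unset Printing Implicit Defensive.
Import Order.TTheory GRing.Theory Num.Theory numFieldNormedType.Exports.
Local Open Scope classical_set_scope.
Local Open Scope ring_scope.
Local Open Scope complex_scope.

(* A possibly unbounded linear operator; [opfun] is only meaningful on [dom]. *)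
Record linear_op (R : realType) (X : completeNormedModType R[i]) := LinearOp {
  dom : set X;
  opfun :> X -> X;
  dom0 : dom 0;
  domP : forall (a : R[i]) (f g : X), dom f -> dom g -> dom (a *: f + g);
  opfunP : forall (a : R[i]) (f g : X), dom f -> dom g ->
    opfun (a *: f + g) = a *: opfun f + opfun g }.

Section Operators.
Variables (R : realType) (X : completeNormedModType R[i]).
Implicit Types (A B : linear_op X) (f g : X).

(* Equality of partial operators, ignoring values outside the domain. *)
Definition op_eq A B := dom A = dom B /\ (forall f, dom A f -> A f = B f).

Program Definition total_op (T : {linear X -> X}) : linear_op X :=
  @LinearOp R X setT T _ _ _.
Next Obligation. by []. Qed.
Next Obligation. by []. Qed.
Next Obligation. by move=> T a f g _ _; rewrite linearP. Qed.

Program Definition id_op : linear_op X := @LinearOp R X setT id _ _ _.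
Next Obligation. by []. Qed.
Next Obligation. by []. Qed.
Next Obligation. by []. Qed.

Lemma opfun0 A : A 0 = 0.
Proof.
have := opfunP 1 (dom0 A) (dom0 A).
by rewrite !scale1r addr0 -{1}[A 0]addr0 => /addrI.
Qed.

Program Definition comp_op A B : linear_op X :=
  @LinearOp R X [set f | dom B f /\ dom A (B f)] (fun f => A (B f)) _ _ _.
Next Obligation.
by move=> A B; split; [exact: dom0 | rewrite opfun0; exact: dom0].
Qed.
Next Obligation.
move=> A B a f g [Bf ABf] [Bg ABg]; split; first exact: domP.
by rewrite opfunP//; exact: domP.
Qed.
Next Obligation.
by move=> A B a f g [Bf ABf] [Bg ABg] /=; rewrite opfunP// opfunP.
Qed.

Definition pow_op A n : linear_op X := iter n (comp_op A) id_op.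

Definition hypercyclic A :=
  exists f : X, [/\ f != 0, (\bigcap_n dom (pow_op A n)) f &
    dense (range (fun n => pow_op A n f))].

Definition hypercyclic_family (I : Type) (J : set I) (T : I -> linear_op X) :=
  exists f : X, [/\ f != 0, (\bigcap_(t in J) dom (T t)) f &
    dense [set T t f | t in J]].

(* [l] is regular when [A - l I] is a bijection of [dom A] onto [X] with a
   bounded inverse. *)
Definition resolvent_set A : set R[i] := [set l |
  exists S : {linear X -> X}, [/\ continuous S,
    forall g, dom A (S g) /\ A (S g) - l *: S g = g &
    forall f, dom A f -> S (A f - l *: f) = f]].

Definition spectrum A : set R[i] := ~` resolvent_set A.

End Operators.

Section SpectralIntegral.
Variables (R : realType) (X : completeNormedModType R[i]).
Implicit Types (F : R[i] -> R[i]) (f g : X).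

Definition borel : set (set R[i]) :=
  <<s [set U : set (R[i] : numFieldType) | open U] >>.

Record spectral_measure (E : set R[i] -> {linear X -> X}) : Prop := {
  spectral_bounded : forall d, borel d -> continuous (E d);
  spectral_proj : forall d f, borel d -> E d (E d f) = E d f;
  spectral0 : forall f, E set0 f = 0;
  spectralT : forall f, E setT f = f;
  spectralI : forall d s f, borel d -> borel s ->
    E (d `&` s) f = E d (E s f);
  spectral_sigma_additive : forall (d : nat -> set R[i]) f,
    (forall n, borel (d n)) -> trivIset setT d ->
    series (fun n => E (d n) f) @ \oo --> E (\bigcup_n d n) f }.

Variable E : set R[i] -> {linear X -> X}.

Definition simple_fun F :=
  finite_set (range F) /\ (forall z, borel (F @^-1` [set z])).

Definition simple_integral F f : X :=
  \sum_(z \in range F) z *: E (F @^-1` [set z]) f.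

(* [T] is the operator-norm limit of the integrals of simple functions
   converging uniformly to [F]. *)
Definition is_bounded_integral F (T : {linear X -> X}) :=
  continuous T /\
  exists s : nat -> R[i] -> R[i],
    [/\ forall n, simple_fun (s n),
        forall e : R[i], 0 < e ->
          \forall n \near \oo, forall z, `|s n z - F z| <= e &
        forall e : R[i], 0 < e ->
          \forall n \near \oo, forall f,
            `|simple_integral (s n) f - T f| <= e * `|f|].

(* The chosen value is unique when [E] is a spectral measure; the default [\0]
   only occurs when [F] is not both bounded and Borel. *)
Definition bounded_integral F : {linear X -> X} :=
  xget (\0 : {classic {linear X -> X}}) (is_bounded_integral F).

Definition truncation F (n : nat) (z : R[i]) : R[i] :=
  F z * \1_[set w | `|F w| <= n%:R] z.

Definition integral_seq F f : nat -> X :=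
  fun n => bounded_integral (truncation F n) f.

Lemma integral_seqP F a f g : integral_seq F (a *: f + g) =
  (fun n => a *: integral_seq F f n + integral_seq F g n).
Proof. by apply/funext => n; rewrite /integral_seq linearP. Qed.

Program Definition spectral_integral F : linear_op X :=
  @LinearOp R X [set f | cvg (integral_seq F f @ \oo)]
    (fun f => lim (integral_seq F f @ \oo)) _ _ _.
Next Obligation.
move=> F /=; have -> : integral_seq F 0 = fun=> 0.
  by apply/funext => n; rewrite /integral_seq linear0.
exact: is_cvg_cst.
Qed.
Next Obligation.
move=> F a f g /= cf cg; rewrite integral_seqP.
by apply: is_cvgD => //; exact: is_cvgZr.
Qed.
Next Obligation.
move=> F a f g /= cf cg; rewrite integral_seqP.
apply: cvg_lim; first exact: norm_hausdorff.
by apply: cvgD => //; exact: cvgZr.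
Qed.

Definition spectral_integral_on (S : set R[i]) F : linear_op X :=
  spectral_integral (fun z => F z * \1_S z).

End SpectralIntegral.

Section ScalarType.
Variables (R : realType) (X : completeNormedModType R[i]).

Definition scalar_type_spectral (A : linear_op X)
    (E : set R[i] -> {linear X -> X}) :=
  spectral_measure E /\ op_eq A (spectral_integral E (fun z => z)).

Definition cexp (z : R[i]) : R[i] :=
  (expR (complex.Re z))%:C *
  (cos (complex.Im z) +i* sin (complex.Im z)).

Definition exp_op (A : linear_op X) (E : set R[i] -> {linear X -> X}) (t : R)
  : linear_op X :=
  spectral_integral_on E (spectrum A) (fun z => cexp (t%:C * z)).

End ScalarType.

Section Semigroup.
Variables (R : realType) (X : completeNormedModType R[i]).

(* Only the values [T t] with [0 <= t] matter. *)
Record C0_semigroup (T : R -> {linear X -> X}) : Prop := {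
  C0_bounded : forall t, 0 <= t -> continuous (T t);
  C0_zero : forall f, T 0 f = f;
  C0_add : forall s t f, 0 <= s -> 0 <= t -> T (s + t) f = T s (T t f);
  C0_continuous : forall f, T t f @[t --> 0^'+] --> f }.

Variable T : R -> {linear X -> X}.

Definition diff_quotient (f : X) (h : R) : X := (h^-1)%:C *: (T h f - f).

Lemma diff_quotientP a f g : diff_quotient (a *: f + g) =
  (fun h => a *: diff_quotient f h + diff_quotient g h).
Proof.
apply/funext => h; rewrite /diff_quotient linearP.
rewrite scalerA mulrC -scalerA -scalerDr; congr (_ *: _).
by rewrite scalerBr opprD addrACA.
Qed.

Program Definition generator : linear_op X :=
  @LinearOp R X [set f | cvg (diff_quotient f @ 0^'+)]
    (fun f => lim (diff_quotient f @ 0^'+)) _ _ _.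
Next Obligation.
move=> /=; have -> : diff_quotient 0 = fun=> 0.
  by apply/funext => h; rewrite /diff_quotient linear0 subr0 scaler0.
exact: is_cvg_cst.
Qed.
Next Obligation.
move=> a f g /= cf cg; rewrite diff_quotientP.
by apply: is_cvgD => //; exact: is_cvgZr.
Qed.
Next Obligation.
move=> a f g /= cf cg; rewrite diff_quotientP.
apply: cvg_lim; first exact: norm_hausdorff.
by apply: cvgD => //; exact: cvgZr.
Qed.

Definition generates (A : linear_op X) := C0_semigroup T /\ op_eq generator A.

End Semigroup.

(* Main.v *)
(* A vector measure E(.)f has bounded range (a set on which it is unbounded can
   be cut so that infinitely many disjoint pieces have measure of norm > 1), so
   the operators E(d) are uniformly bounded by Banach-Steinhaus, and
   F |-> \int F dE is a bounded multiplicative calculus on bounded Borel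
   functions.  A vector f lies in the domain of an unbounded G(A), with
   G(A) f = g, iff H(A) g = (H G)(A) f whenever H and H G are bounded.

   Non-hypercyclicity: let d be {|z| > 1} for the powers z^n, and the part of
   the spectrum in {Re z > 0} for the exponentials e^{tz}.  If E(d) f <> 0, then
   E(d) f = (1_d / G)(A) (G(A) f) keeps the orbit away from 0; otherwise the
   orbit is that of a vector carried by {|G| <= 1}, hence bounded.

   A point is in the resolvent set iff some disc around it is E-null; by
   separability the spectrum is Borel and E(spectrum) = I.  If Re z <= w on the
   spectrum, the exponentials are bounded functions, and the slopes
   (e^{hz} - 1) / (hz) are bounded uniformly in h and tend to 1 locally
   uniformly, which identifies the generator with A.  Another semigroup T'
   generated by A is compared with T on the spectral subspaces {|z| <= n}, where
   T(h) = I + hA + O(h^2), by telescoping over N steps of length t/N. *)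
Require Import Defs.
From HB Require Import structures.
From mathcomp Require Import all_boot all_order all_algebra.
From mathcomp Require Import complex.
From mathcomp Require Import all_classical all_reals all_analysis.
From mathcomp Require Import measurable_realfun.
From mathcomp Require Import ring lra zify.
Set Implicit Arguments.
Unset Strict Implicit.
Unset Printing Implicit Defensive.
Import Order.TTheory GRing.Theory Num.Theory numFieldNormedType.Exports.
Local Open Scope classical_set_scope.
Local Open Scope ring_scope.
Local Open Scope complex_scope.

(** Every claim about an unbounded operator is tested against bounded functions [H] ([integrates]).
    This trades limits of truncated integrals and domains of compositions for identities between
    bounded integrals. Integrals are bounded straight from the projections: a subsum of E over
    fibres is again one projection, and convexity of the norm reduces arbitrary coefficients to 0
    and 1. [E] is not assumed to live on the spectrum, which is defined through resolvents, whereas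
    [exp_op] integrates over the spectrum only. The identity E(spectrum) = I therefore has to be
    derived from null discs before even T(0) = I is available. Uniqueness is proved because the
    statement speaks of the semigroup generated by [A]. A rival T' is known only through its
    generator and is not known to commute with [E]. The projection onto a disc is therefore applied
    after T', and A T'(s) f = T'(s) A f lets the first-order terms cancel. *)

(** * Real-valued norms: topology, convergence and bounded operators *)

Section RealNorm.
Variable R : realType.

(* The norm of a space over R[i] takes values in R[i], which is only partially
   ordered; [rnorm] is the same norm as an element of R. *)
Definition rnorm (V : normedZmodType R[i]) (x : V) : R := complex.Re `|x|.

Section NormedZmod.
Variable V : normedZmodType R[i].
Implicit Types x y : V.

Lemma rnormE x : (rnorm x)%:C = `|x|.
Proof.
have := normr_ge0 x; rewrite /rnorm lecE /=; case: (`|x|) => a b /=.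
by move=> /andP[/eqP ->].
Qed.

Lemma ler_rnorm x (e : R) : (`|x| <= e%:C) = (rnorm x <= e).
Proof. by rewrite -rnormE lecR. Qed.

Lemma rnorm_ge0 x : 0 <= rnorm x.
Proof. by rewrite -lecR rnormE normr_ge0. Qed.

Lemma rnorm0 : rnorm (0 : V) = 0.
Proof. by rewrite /rnorm normr0. Qed.

Lemma rnorm_eq0 x : rnorm x = 0 -> x = 0.
Proof.
move=> x0; apply/eqP; rewrite -normr_eq0 -rnormE x0; exact: eqxx.
Qed.

Lemma rnorm_gt0 x : x != 0 -> 0 < rnorm x.
Proof.
move=> x0; rewrite lt_neqAle rnorm_ge0 andbT eq_sym.
by apply/eqP => /rnorm_eq0 /eqP; rewrite (negPf x0).
Qed.

Lemma rnorm_le0 x : rnorm x <= 0 -> x = 0.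
Proof. by move=> x0; apply: rnorm_eq0; apply/le_anti; rewrite x0 rnorm_ge0. Qed.

Lemma rnormD x y : rnorm (x + y) <= rnorm x + rnorm y.
Proof. by rewrite -lecR rmorphD /= !rnormE ler_normD. Qed.

Lemma rnormN x : rnorm (- x) = rnorm x.
Proof. by rewrite /rnorm normrN. Qed.

Lemma rdistC x y : rnorm (x - y) = rnorm (y - x).
Proof. by rewrite /rnorm distrC. Qed.

Lemma rnormB x y : rnorm (x - y) <= rnorm x + rnorm y.
Proof. by rewrite -(rnormN y) rnormD. Qed.

Lemma rnorm_sum (I : Type) (s : seq I) (P : pred I) (F : I -> V) :
  rnorm (\sum_(i <- s | P i) F i) <= \sum_(i <- s | P i) rnorm (F i).
Proof.
elim/big_rec2: _ => [|i y1 y2 _ h]; first by rewrite rnorm0.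
by rewrite (le_trans (rnormD _ _))// lerD2l.
Qed.

End NormedZmod.

Lemma rnormM (z w : R[i]) : rnorm (z * w) = rnorm z * rnorm w.
Proof. by apply: complexI; rewrite rmorphM /= !rnormE normrM. Qed.

Lemma rnorm1 : rnorm (1 : R[i]) = 1.
Proof. by rewrite /rnorm normr1. Qed.

Lemma rnormV (z : R[i]) : rnorm z^-1 = (rnorm z)^-1.
Proof. by apply: complexI; rewrite fmorphV /= !rnormE normfV. Qed.

Lemma rnormX (z : R[i]) n : rnorm (z ^+ n) = rnorm z ^+ n.
Proof. by elim: n => [|n IH]; rewrite ?expr0 ?rnorm1// !exprS rnormM IH. Qed.

Lemma rnormC (x : R) : rnorm x%:C = `|x|.
Proof. by rewrite /rnorm normc_def /= expr0n /= addr0 sqrtr_sqr. Qed.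

Lemma scaleC_rnorm (h : R) (z : R[i]) : 0 <= h -> rnorm (h%:C * z) = h * rnorm z.
Proof. by move=> h0; rewrite rnormM rnormC ger0_norm. Qed.

Lemma Re_scale (t : R) (z : R[i]) : complex.Re (t%:C * z) = t * complex.Re z.
Proof. by case: z => a b /=; rewrite mul0r subr0. Qed.

Lemma rnorm_sqrt (z : R[i]) :
  rnorm z = Num.sqrt (complex.Re z ^+ 2 + complex.Im z ^+ 2).
Proof. by rewrite /rnorm normc_def. Qed.

Lemma Re_le_rnorm (z : R[i]) : `|complex.Re z| <= rnorm z.
Proof.
by rewrite rnorm_sqrt -[leLHS]sqrtr_sqr ler_wsqrtr// lerDl sqr_ge0.
Qed.

Lemma Im_le_rnorm (z : R[i]) : `|complex.Im z| <= rnorm z.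
Proof.
by rewrite rnorm_sqrt -[leLHS]sqrtr_sqr ler_wsqrtr// lerDr sqr_ge0.
Qed.

Lemma rnorm_le_ReIm (z : R[i]) :
  rnorm z <= `|complex.Re z| + `|complex.Im z|.
Proof.
rewrite rnorm_sqrt -(@ler_pXn2r _ 2)// ?nnegrE ?sqrtr_ge0 ?addr_ge0//.
rewrite sqr_sqrtr ?addr_ge0 ?sqr_ge0// sqrrD !real_normK ?num_real//.
by rewrite -addrA addrCA lerDr addr_ge0// ?mulrn_wge0 ?mulr_ge0 ?sqr_ge0.
Qed.

Section NormedMod.
Variable V : normedModType R[i].
Implicit Types x y : V.

Lemma rnormZ (a : R[i]) x : rnorm (a *: x) = rnorm a * rnorm x.
Proof. by apply: complexI; rewrite rmorphM /= !rnormE normrZ. Qed.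

Lemma gt0_complexP (e : R[i]) : 0 < e -> exists2 r : R, 0 < r & e = r%:C.
Proof.
by case: e => a b; rewrite ltcE /= => /andP[/eqP -> a0]; exists a.
Qed.

Lemma cvg_rnormP (T : Type) (F : set_system T) {FF : Filter F} (f : T -> V)
    (l : V) :
  f @ F --> l <->
  (forall e : R, 0 < e -> \forall x \near F, rnorm (f x - l) <= e).
Proof.
split => [/cvgrPdist_le h e e0|h].
  have := h e%:C; rewrite ltcR => /(_ e0).
  by apply: filterS => x; rewrite ler_rnorm rdistC.
apply/cvgrPdist_le => e /gt0_complexP[r r0 ->].
by have := h _ r0; apply: filterS => x; rewrite ler_rnorm rdistC.
Qed.

Lemma rnorm_ball x (r : R) y : ball x r%:C y <-> rnorm (x - y) < r.
Proof. by rewrite -ball_normE /ball_ /= -rnormE ltcR. Qed.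

Lemma open_rnormP (O : set V) :
  open O <-> forall x, O x -> exists2 r : R, 0 < r &
    forall y, rnorm (x - y) < r -> O y.
Proof.
rewrite openE; split => [h x /h|h x /h [r r0 hr]]; rewrite /interior.
  move=> /nbhs_ballP[e /gt0_complexP[r r0 ->] he]; exists r => // y xy.
  by apply: he; apply/rnorm_ball.
apply/nbhs_ballP; exists r%:C => /=; first by rewrite ltcR.
by move=> y /rnorm_ball; exact: hr.
Qed.

Lemma rnorm_lim_le (T : Type) (F : set_system T) {FF : ProperFilter F}
    (f : T -> V) (l : V) (b : R) :
  f @ F --> l -> (\forall x \near F, rnorm (f x) <= b) -> rnorm l <= b.
Proof.
move=> /cvg_rnormP fl fb; apply/ler_addgt0Pr => e e0.
have [x [fx fe]] := filter_ex (filterI fb (fl _ e0)).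
rewrite -[l](subrK (f x)) (le_trans (rnormD _ _))// addrC lerD//.
by rewrite rdistC.
Qed.

End NormedMod.

Lemma rnorm_cauchy_cvg (V : completeNormedModType R[i]) (u : nat -> V) :
  (forall e : R, 0 < e -> exists N, forall n m, (N <= n)%N -> (N <= m)%N ->
    rnorm (u n - u m) <= e) -> cvg (u @ \oo).
Proof.
move=> h; apply/cauchy_cvgP/cauchy_exP => e /gt0_complexP[r r0 ->].
have [N hN] := h _ (divr_gt0 r0 (ltr0n _ 2)).
exists (u N); exists N => // n Nn; apply/rnorm_ball.
by apply: (@le_lt_trans _ _ (r / 2)); [exact: hN|lra].
Qed.

Lemma linear_rnorm_continuous (V : normedModType R[i]) (f : {linear V -> V})
    (M : R) :
  (forall x, rnorm (f x) <= M * rnorm x) -> continuous f.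
Proof.
move=> hM; apply: bounded_linear_continuous; apply/linear_boundedP.
near=> r => x.
suff Mr : M%:C <= r.
  by rewrite (le_trans _ (ler_wpM2r _ Mr))// -!rnormE -rmorphM lecR.
near: r; apply: nbhs_pinfty_ge; by apply/complex_realP; exists M.
Unshelve. all: by end_near.
Qed.

Lemma continuous_linear_rnorm (V : normedModType R[i]) (f : {linear V -> V}) :
  continuous f -> exists2 M : R, 0 < M & forall x, rnorm (f x) <= M * rnorm x.
Proof.
move=> /linear_bounded_continuous /linear_boundedP /pinfty_ex_gt0.
move=> [_ /gt0_complexP[r r0 ->] h]; exists r => // x.
by have := h x; rewrite -!rnormE -rmorphM lecR.
Qed.

End RealNorm.

(** * The uniform boundedness principle over complex scalars *)

Section UniformBoundedness.
Variables (R : realType) (V : completeNormedModType R[i]).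

(* [Banach_Steinhauss] only covers real scalars.  If the bound fails, nested
   balls are chosen on the n-th of which some T i has norm > n; the common point
   of these balls contradicts pointwise boundedness. *)
Lemma uniform_boundedness (I : Type) (T : I -> {linear V -> V}) :
  (forall i, continuous (T i)) ->
  (forall x, exists M : R, forall i, rnorm (T i x) <= M) ->
  exists M : R, forall i x, rnorm (T i x) <= M * rnorm x.
Proof.
move=> Tc Tb; apply: contrapT => H.
have {}H (M : R) : exists i x, M * rnorm x < rnorm (T i x).
  apply: contrapT => h; apply: H; exists M => i x.
  by rewrite leNgt; apply/negP => hx; apply: h; exists i, x.
(* [a] is a closed ball with a stage number, [b] the next ball inside it. The premise on the radius
   sits inside the relation so that every [a] has a successor, as choice demands; [s0] discharges
   it. *)
pose nxt (a : V * R * nat) (b : V * R) := 0 < a.1.2 ->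
  [/\ 0 < b.2, b.2 <= a.1.2 / 2,
     forall y, rnorm (b.1 - y) <= b.2 -> rnorm (a.1.1 - y) <= a.1.2 &
     exists i, forall y, rnorm (b.1 - y) <= b.2 -> a.2%:R < rnorm (T i y)].
have /choice[g hg] a : exists b, nxt a b.
  case: a => -[x r] n; rewrite /nxt /=.
  have [r0|r0] := ltP 0 r; last by exists (x, r) => /=; rewrite ltNge r0.
  (* The constant is chosen so that h, rescaled to norm r / 2, still has an image of norm above n +
     1. *)
  have [i [h hh]] := H (n.+1%:R * 2 / r).
  have h0 : 0 < rnorm h.
    apply: rnorm_gt0; apply/eqP => h0; move: hh.
    by rewrite h0 linear0 rnorm0 mulr0 ltxx.
  pose k := (r / 2 / rnorm h)%:C *: h.
  have kn : rnorm k = r / 2.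
    rewrite rnormZ rnormC ger0_norm ?divr_ge0 ?(ltW r0) ?(ltW h0)//.
    by rewrite divfK// gt_eqF.
  have Tk : n.+1%:R < rnorm (T i k).
    rewrite linearZ rnormZ rnormC ger0_norm ?divr_ge0 ?(ltW r0) ?(ltW h0)//.
    rewrite -(@ltr_pM2l _ (r / 2 / rnorm h)) in hh; last by rewrite !divr_gt0.
    apply: le_lt_trans hh.
    by rewrite le_eqVlt; apply/orP; left; apply/eqP; field; rewrite !gt_eqF.
  (* T i (x + k) - T i (x - k) = 2 T i k has norm above 2 (n + 1), so one of the two points is sent
     beyond n + 1. *)
  have [x' xx' Tx'] : exists2 x', rnorm (x - x') = r / 2 &
      n.+1%:R < rnorm (T i x').
    have [h1|h1] := ltP n.+1%:R (rnorm (T i (x + k))).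
      by exists (x + k) => //; rewrite opprD addNKr rnormN kn.
    exists (x - k); first by rewrite opprD opprK addNKr kn.
    have := rnormB (T i (x + k)) (T i (x - k)); rewrite -linearB.
    rewrite opprD opprK addrACA subrr add0r linearD.
    have -> : T i k + T i k = 2%:R%:C *: T i k.
      by rewrite rmorph_nat scaler_nat mulr2n.
    by rewrite rnormZ rnormC ger0_norm//; lra.
  have [B B0 hB] := continuous_linear_rnorm (Tc i).
  (* Radius r / 2 keeps the ball inside the old one, as |x - x'| = r / 2. Within B^-1 of x' the
     values of T i vary by at most 1, which turns n + 1 into n. *)
  exists (x', Num.min (r / 2) B^-1) => /= _; split.
  - by rewrite lt_min divr_gt0// invr_gt0.
  - by rewrite ge_min lexx.
  - move=> y; rewrite le_min => /andP[yr _].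
    rewrite -[x](subrK x') -addrA (le_trans (rnormD _ _))// xx'.
    by rewrite [r in leRHS](splitr r) lerD2l.
  - exists i => y; rewrite le_min => /andP[_ yB].
    have := rnormD (T i (x' - y)) (T i y); rewrite -linearD subrK.
    have : rnorm (T i (x' - y)) <= 1.
      by rewrite (le_trans (hB _))// -ler_pdivlMl// mulr1.
    move: Tx'; rewrite -natr1; lra.
pose s := fix s n := if n is m.+1 then g (s m, m) else (0 : V, 1 : R).
have s0 n : 0 < (s n).2.
  by elim: n => [|n IH]; [rewrite ltr01 | case: (hg (s n, n) IH)].
have s2 n : (s n).2 <= 2^-1 ^+ n.
  elim: n => [|n IH]; first by rewrite expr0.
  have [_ h _ _] := hg (s n, n) (s0 n).
  by rewrite (le_trans h)//= exprS mulrC ler_wpM2l// invr_ge0.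
have sD n k y : rnorm ((s (n + k)%N).1 - y) <= (s (n + k)%N).2 ->
    rnorm ((s n).1 - y) <= (s n).2.
  elim: k => [|k IH]; first by rewrite addn0.
  rewrite addnS => h; apply: IH.
  by have [_ _ + _] := hg (s (n + k)%N, (n + k)%N) (s0 _); exact.
have sN n m : (n <= m)%N -> rnorm ((s n).1 - (s m).1) <= (s n).2.
  move=> /subnKC <-; apply: (@sD _ (m - n)%N).
  by rewrite subrr rnorm0 ltW.
have cs : cvg ((fst \o s) @ \oo).
  apply: rnorm_cauchy_cvg => e e0.
  have [N _ hN] : \forall n \near \oo, 2^-1 ^+ n < e / 2 :> R.
    apply: (cvgr_lt 0); last by rewrite divr_gt0.
    by apply: cvg_expr; rewrite ger0_norm ?invf_lt1 ?invr_ge0// ltr1n.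
  exists N => n m Nn Nm /=.
  rewrite -[(s n).1](subrK (s N).1) -addrA (le_trans (rnormD _ _))//.
  rewrite rdistC [e]splitr lerD//.
    by rewrite (le_trans (sN _ _ Nn))// (le_trans (s2 _))// ltW// hN/=.
  by rewrite (le_trans (sN _ _ Nm))// (le_trans (s2 _))// ltW// hN/=.
pose x := lim ((fst \o s) @ \oo).
have sx n : rnorm ((s n).1 - x) <= (s n).2.
  apply: (@rnorm_lim_le _ _ _ \oo _ (fun m => (s n).1 - (s m).1)).
    by apply: cvgB; [exact: cvg_cst|exact: cs].
  by exists n => // m; exact: sN.
have [M hM] := Tb x.
have [_ _ _ [i hi]] := hg (s (Num.truncn M).+1, (Num.truncn M).+1) (s0 _).
have := hi _ (sx (Num.truncn M).+2); rewrite ltNge => /negP; apply.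
by rewrite (le_trans (hM i))// ltW// truncnS_gt.
Qed.

End UniformBoundedness.

(** * Borel sets of the complex plane *)

Section Borel.
Variable R : realType.
Implicit Types a b : set R[i].

(** Presents the plane as a measurable type, so that results on measurable real functions apply to
    real and imaginary parts. *)
Definition cborel := g_sigma_algebraType
  [set U : set (R[i] : numFieldType) | open U].

Lemma borelT : borel (setT : set R[i]).
Proof. exact: (@measurableT _ cborel). Qed.

Lemma borel0 : borel (set0 : set R[i]).
Proof. exact: (@measurable0 _ cborel). Qed.

Lemma borelC a : borel a -> borel (~` a).
Proof. exact: (@measurableC _ cborel). Qed.

Lemma borelI a b : borel a -> borel b -> borel (a `&` b).
Proof. exact: (@measurableI _ cborel). Qed.

Lemma borelU a b : borel a -> borel b -> borel (a `|` b).
Proof. exact: (@measurableU _ cborel). Qed.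

Lemma borelD a b : borel a -> borel b -> borel (a `\` b).
Proof. exact: (@measurableD _ cborel). Qed.

Lemma borel_bigcup (d : nat -> set R[i]) :
  (forall n, borel (d n)) -> borel (\bigcup_n d n).
Proof. move=> hd; apply: (@bigcupT_measurable _ cborel); exact: hd. Qed.

Lemma borel_bigsetU n (d : nat -> set R[i]) :
  (forall n, borel (d n)) -> borel (\big[setU/set0]_(i < n) d i).
Proof.
move=> hd; apply: (@bigsetU_measurable _ cborel) => i _; exact: hd.
Qed.

Lemma borel_open (a : set (R[i] : numFieldType)) : open a -> borel a.
Proof. by move=> oa; exact: sub_sigma_algebra. Qed.

End Borel.

(** * Spectral measures: additivity, monotone limits, uniform bound *)

Section SpectralMeasure.
Variables (R : realType) (X : completeNormedModType R[i]).
Variable E : set R[i] -> {linear X -> X}.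
Hypothesis hE : spectral_measure E.
Implicit Types (a b d : set R[i]) (f : X).

Lemma spectralU a b f : borel a -> borel b -> a `&` b = set0 ->
  E (a `|` b) f = E a f + E b f.
Proof.
move=> ma mb ab0; pose c := bigcup2 a b.
have mc n : borel (c n) by case: n => [|[|n]]//; exact: borel0.
have tc : trivIset setT c by rewrite -trivIset_bigcup2.
have := @spectral_sigma_additive _ _ _ hE _ f mc tc; rewrite bigcup2E => h.
apply: (cvg_unique _ h); first exact: norm_hausdorff.
apply: cvg_near_cst; exists 2%N => // -[|[|n]]// _.
rewrite seriesEnat /= !big_nat_recl//= big1 ?addr0//.
by move=> i _; rewrite (spectral0 hE).
Qed.

Lemma spectralD a b f : borel a -> borel b ->
  E (a `\` b) f = E a f - E (a `&` b) f.
Proof.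
move=> ma mb; rewrite -[in E a](setUIDK a b).
rewrite spectralU ?addKr//; [|exact: borelI|exact: borelD|].
  by rewrite addrAC subrr add0r.
by rewrite setDE setIACA setICr setI0.
Qed.

Lemma spectral_sub0 a b f : borel a -> borel b -> a `<=` b -> E b f = 0 ->
  E a f = 0.
Proof.
by move=> ma mb ab b0; rewrite -(setIidl ab) (spectralI hE)// b0 linear0.
Qed.

Lemma spectral_bigcup0 (d : nat -> set R[i]) f : (forall n, borel (d n)) ->
  (forall n, E (d n) f = 0) -> E (\bigcup_n d n) f = 0.
Proof.
move=> md d0; rewrite seqDU_bigcup_eq.
have mD n : borel (seqDU d n).
  by apply: borelD => //; exact: borel_bigsetU.
have := @spectral_sigma_additive _ _ _ hE _ f mD (trivIset_seqDU d).
suff -> : (fun n => E (seqDU d n) f) = fun=> 0.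
  move=> h; apply: (cvg_unique _ h); first exact: norm_hausdorff.
  apply: cvg_near_cst; exists 0%N => // n _.
  by rewrite seriesEnat /= big1.
by apply/funext => n; apply: (spectral_sub0 (mD n) (md n)) => //; exact: subset_seqDU.
Qed.

(** Cutting the sequence into disjoint differences makes E (d n) f a partial sum of the series given
    by countable additivity. *)
Lemma spectral_incr_cvg (d : nat -> set R[i]) f : (forall n, borel (d n)) ->
  (forall n, d n `<=` d n.+1) -> \bigcup_n d n = setT ->
  (fun n => E (d n) f) @ \oo --> f.
Proof.
move=> md dS dT.
have nd : nondecreasing_seq d.
  by apply/nondecreasing_seqP => n; apply/subsetPset; exact: dS.
have mD n : borel (seqDU d n).
  by apply: borelD => //; exact: borel_bigsetU.
have := @spectral_sigma_additive _ _ _ hE _ f mD (trivIset_seqDU d).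
rewrite -seqDU_bigcup_eq dT (spectralT hE) => h.
rewrite -(cvg_shiftS (series _)) in h.
suff -> : (fun n => E (d n) f) =
  (fun n => series (fun n => E (seqDU d n) f) n.+1) by [].
apply/funext => n; rewrite seriesEnat/=.
have -> : d n = \big[setU/set0]_(i < n.+1) seqDU d i.
  by rewrite seqDU_seqD// nondecreasing_bigsetU_seqD.
elim: n => [|n IH]; first by rewrite big_nat1 big_ord1.
rewrite big_ord_recr/= [in RHS]big_nat_recr//= -IH spectralU//.
  exact: (@borel_bigsetU _ n.+1 (seqDU d)).
apply/seteqP; split => // x [].
by rewrite -bigsetU_seqDU => h1 [_].
Qed.

Let large f b := borel b /\
  forall M : R, exists a, [/\ borel a, a `<=` b & M < rnorm (E a f)].

(* If E(.)f were unbounded below b, one of the two halves of a cut of b on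
   which E(.)f is large would inherit the unboundedness. *)
Let large_split f b : large f b ->
  exists a, [/\ large f a, a `<=` b & 1 < rnorm (E (b `\` a) f)].
Proof.
(* The margin 1 forces E (b \ s) f, like E s f, to have norm above 1. Either half may then be kept
   and the other cut off. *)
move=> [mb lb]; have [s [ms sb hs]] := lb (rnorm (E b f) + 1).
have bs : 1 < rnorm (E (b `\` s) f).
  rewrite spectralD// (setIidr sb) rdistC.
  have := rnormD (E s f - E b f) (E b f); rewrite subrK; lra.
have [[ls]|ls] := pselect (large f s); first by exists s.
exists (b `\` s); split; last 2 first.
- exact: subDsetl.
- by rewrite setDD (setIidr sb); have := rnorm_ge0 (E b f); lra.
split; first exact: borelD.
move=> M; apply: contrapT => hM; apply: ls; split => // M'.
(* At most M of this norm comes from the part of [a] outside s, so more than M' remains inside. *)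
have [a [ma ab ha]] := lb (M + M'); exists (a `&` s); split => //.
- exact: borelI.
- have : rnorm (E (a `\` s) f) <= M.
    rewrite leNgt; apply/negP => h; apply: hM; exists (a `\` s); split => //.
      exact: borelD.
    exact: setSD.
  have := rnormD (E (a `&` s) f) (E (a `\` s) f); rewrite -spectralU.
  + by rewrite setUIDK; lra.
  + exact: borelI.
  + exact: borelD.
  + by rewrite setDE setIACA setICr setI0.
Qed.

Lemma spectral_pointwise_bounded f :
  exists M : R, forall d, borel d -> rnorm (E d f) <= M.
Proof.
apply: contrapT => h.
have lT : large f setT.
  split; first exact: borelT.
  move=> M; apply: contrapT => hM; apply: h; exists M => d md.
  by rewrite leNgt; apply/negP => hd; apply: hM; exists d.
have /choice[g hg] b : exists a, large f b ->
    [/\ large f a, a `<=` b & 1 < rnorm (E (b `\` a) f)].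
  have [/large_split[a ha]|nb] := pselect (large f b); first by exists a.
  by exists set0.
pose s n := iter n g setT.
have ls n : large f (s n) by elim: n => // n /hg[].
have sS n : s n.+1 `<=` s n by have [] := hg _ (ls n).
have sM n k : s (n + k)%N `<=` s n.
  by elim: k => [|k IH]; rewrite ?addn0// addnS => x /sS /IH.
pose d n := s n `\` s n.+1.
have md n : borel (d n) by apply: borelD; case: (ls n); case: (ls n.+1).
have td : trivIset setT d.
  apply: ltn_trivIset => n m mn; apply/seteqP; split => // x [[_ dm] [dn _]].
  by apply: dm; apply: (@sM m.+1 (n - m.+1)%N); rewrite subnKC.
(* Countable additivity makes the series over the disjoint pieces converge, so its terms tend to 0,
   yet each has norm above 1. *)
have /cvgP/cvg_series_cvg_0/cvg_rnormP/(_ _ ltr01) :=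
  @spectral_sigma_additive _ _ _ hE _ f md td.
move=> [N _ /(_ N (leqnn N))]/=; rewrite subr0 leNgt => /negP; apply.
by have [] := hg _ (ls N).
Qed.

Lemma spectral_uniformly_bounded :
  exists2 M : R, 0 < M & forall d f, borel d -> rnorm (E d f) <= M * rnorm f.
Proof.
pose T (d : {d : set R[i] | borel d}) := E (sval d).
have [M hM] : exists M : R, forall i x, rnorm (T i x) <= M * rnorm x.
  apply: uniform_boundedness => [[d md]|f]; first exact: (spectral_bounded hE).
  have [M hM] := spectral_pointwise_bounded f.
  by exists M => -[d md]; exact: hM.
exists (Num.max M 1); first by rewrite lt_max ltr01 orbT.
move=> d f md; apply: (le_trans (hM (exist _ d md) f)).
by rewrite ler_wpM2r ?rnorm_ge0// le_max lexx.
Qed.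

End SpectralMeasure.

(** * Norms of linear combinations with bounded coefficients *)

Section ConvexBound.
Variables (R : realType) (X : normedModType R[i]).

(* A convex function on a cube is maximal at a vertex. *)
Lemma rnorm_sum_vertex (T : eqType) (s : seq T) (a : T -> R) (v : T -> X)
    (u : X) : uniq s -> (forall p, 0 <= a p <= 1) ->
  exists b : pred T, rnorm (u + \sum_(p <- s) (a p)%:C *: v p) <=
    rnorm (u + \sum_(p <- s | b p) v p).
Proof.
move=> us ha; elim: s us u => [_ u|p s IH /= /andP[ps us] u].
  by exists xpredT; rewrite !big_nil.
(* The term of p is frozen into the base point while the other coefficients move to a vertex;
   convexity in the coefficient of p alone then decides its value. *)
have [b hb] := IH us (u + (a p)%:C *: v p).
set w := \sum_(q <- s | b q) v q in hb.
have hs (c : pred T) : {in s, c =1 b} -> \sum_(q <- s | c q) v q = w.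
  by move=> cb; rewrite /w big_seq_cond [RHS]big_seq_cond;
     apply: eq_bigl => q; case: (boolP (q \in s)) => // /cb.
(* Since p does not occur in s, the value of [b] at p can be set freely. *)
have hpred (c : bool) :
    exists b', b' p = c /\ \sum_(q <- s | b' q) v q = w.
  exists (fun q => if q == p then c else b q); rewrite eqxx; split => //.
  by apply: hs => q qs; case: eqP => // qp; rewrite -qp qs in ps.
have [a0 a1] := andP (ha p).
have key : rnorm (u + (a p)%:C *: v p + w) <=
    (1 - a p) * rnorm (u + w) + a p * rnorm (u + (v p + w)).
  have -> : u + (a p)%:C *: v p + w =
      (1 - a p)%:C *: (u + w) + (a p)%:C *: (u + (v p + w)).
    rewrite rmorphB rmorph1 scalerBl scale1r (addrCA u) (scalerDr _ (v p)) /=.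
    by rewrite [RHS]addrCA subrK [RHS]addrC addrAC.
  rewrite (le_trans (rnormD _ _))// !rnormZ !rnormC ger0_norm ?subr_ge0//.
  by rewrite (ger0_norm a0).
rewrite big_cons addrA.
have [le|/ltW le] := leP (rnorm (u + (v p + w))) (rnorm (u + w)).
  have [b' [bp bw]] := hpred false; exists b'; rewrite big_cons bp bw.
  rewrite (le_trans hb)// (le_trans key)//.
  rewrite (@le_trans _ _ ((1 - a p) * rnorm (u + w) + a p * rnorm (u + w)))//.
    by rewrite lerD2l ler_wpM2l.
  by rewrite -mulrDl subrK mul1r.
have [b' [bp bw]] := hpred true; exists b'; rewrite big_cons bp bw.
rewrite (le_trans hb)// (le_trans key)//.
rewrite (@le_trans _ _ ((1 - a p) * rnorm (u + (v p + w)) +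
                        a p * rnorm (u + (v p + w))))//.
  by rewrite lerD2r ler_wpM2l// subr_ge0.
by rewrite -mulrDl subrK mul1r.
Qed.

(* Splitting a coefficient into positive and negative real and imaginary parts
   costs a factor 4. *)
Lemma rnorm_sum_le (T : eqType) (s : seq T) (a : T -> R[i]) (v : T -> X)
    (c M : R) : uniq s -> 0 <= c -> (forall p, rnorm (a p) <= c) ->
  (forall b : pred T, rnorm (\sum_(p <- s | b p) v p) <= M) ->
  rnorm (\sum_(p <- s) a p *: v p) <= 4 * c * M.
Proof.
move=> us; rewrite le_eqVlt => /orP[/eqP <- a0 _|c0 ac hM].
  rewrite big1 ?rnorm0 ?mulr0 ?mul0r// => p _.
  by rewrite (rnorm_le0 (a0 p)) scale0r.
have real (r : T -> R) : (forall p, 0 <= r p <= c) ->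
    rnorm (\sum_(p <- s) (r p)%:C *: v p) <= c * M.
  move=> hr; have hr1 p : 0 <= r p / c <= 1.
    have /andP[r0 r1] := hr p.
    by rewrite divr_ge0 ?(ltW c0)//= ler_pdivrMr// mul1r.
  have [b hb] := rnorm_sum_vertex v 0 us hr1; rewrite !add0r in hb.
  have -> : \sum_(p <- s) (r p)%:C *: v p =
      c%:C *: \sum_(p <- s) (r p / c)%:C *: v p.
    rewrite scaler_sumr; apply: eq_bigr => p _.
    by rewrite scalerA -rmorphM mulrC divfK// gt_eqF.
  rewrite rnormZ rnormC ger0_norm ?(ltW c0)// ler_pM2l//.
  exact: le_trans hb (hM b).
pose pos (x : R) := Num.max x 0.
have posB x : x = pos x - pos (- x).
  by rewrite /pos; case: (leP x 0) => hx; case: (leP (- x) 0) => hx'; lra.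
have posP x : `|x| <= c -> 0 <= pos x <= c.
  rewrite ler_norml => /andP[h1 h2].
  by rewrite /pos; case: (leP x 0) => hx; lra.
have Rep p := le_trans (Re_le_rnorm (a p)) (ac p).
have Imp p := le_trans (Im_le_rnorm (a p)) (ac p).
have dec p : a p *: v p =
    ((pos (complex.Re (a p)))%:C *: v p -
     (pos (- complex.Re (a p)))%:C *: v p) +
    'i *: ((pos (complex.Im (a p)))%:C *: v p -
           (pos (- complex.Im (a p)))%:C *: v p).
  by rewrite -!scalerBl -!rmorphB -!posB scalerA -scalerDl -complexE.
have i1 : rnorm ('i : R[i]) = 1.
  by rewrite rnorm_sqrt/= expr0n/= add0r expr1n sqrtr1.
under eq_bigr do rewrite dec.
rewrite big_split/= -scaler_sumr !sumrB (le_trans (rnormD _ _))//.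
rewrite rnormZ i1 mul1r.
set s1 := \sum_(i <- s) _; set s2 := \sum_(i <- s) _.
set s3 := \sum_(i <- s) _; set s4 := \sum_(i <- s) _.
have h1 : rnorm s1 <= c * M by apply: real => p; exact: posP.
have h2 : rnorm s2 <= c * M by apply: real => p; apply: posP; rewrite normrN.
have h3 : rnorm s3 <= c * M by apply: real => p; exact: posP.
have h4 : rnorm s4 <= c * M by apply: real => p; apply: posP; rewrite normrN.
by have := rnormB s1 s2; have := rnormB s3 s4; lra.
Qed.

End ConvexBound.

(** * Simple functions and finite Borel partitions *)

Section SimpleIntegral.
Variables (R : realType) (X : completeNormedModType R[i]).
Variable E : set R[i] -> {linear X -> X}.
Hypothesis hE : spectral_measure E.
Implicit Types (a b d : set R[i]) (f : X) (F G : R[i] -> R[i]).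

Lemma borel_preimage_seq (T : eqType) (H : R[i] -> T) (s : seq T) :
  (forall p, borel (H @^-1` [set p])) -> borel [set x | H x \in s].
Proof.
move=> bH; elim: s => [|p s IH].
  rewrite (_ : [set _ | _] = set0); first exact: borel0.
  by apply/seteqP; split.
rewrite (_ : [set _ | _] = H @^-1` [set p] `|` [set x | H x \in s]).
  exact: borelU.
apply/seteqP; split => x /=; rewrite in_cons.
  by move=> /orP[/eqP|]; [left|right].
by move=> [->|->]; rewrite ?eqxx ?orbT.
Qed.

Lemma spectral_preimage_seq (T : eqType) (H : R[i] -> T) (s : seq T) f :
  uniq s -> (forall p, borel (H @^-1` [set p])) ->
  E [set x | H x \in s] f = \sum_(p <- s) E (H @^-1` [set p]) f.
Proof.
move=> us bH; elim: s us => [_|p s IH /= /andP[ps us]].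
  rewrite big_nil (_ : [set _ | _] = set0) ?(spectral0 hE)//.
  by apply/seteqP; split.
rewrite big_cons -IH// -spectralU//; last first.
- by apply/seteqP; split => // x [/= -> ]; rewrite (negPf ps).
- exact: borel_preimage_seq.
congr (E _ f); apply/seteqP; split => x /=; rewrite in_cons.
  by move=> /orP[/eqP|]; [left|right].
by move=> [->|->]; rewrite ?eqxx ?orbT.
Qed.

(* A simple function is handled through any Borel partition on which it is
   constant: the fibres of [H], enumerated by [s]. *)
Lemma simple_integral_partition (T : eqType) (H : R[i] -> T) (s : seq T)
    (phi : T -> R[i]) f :
  uniq s -> (forall x, H x \in s) -> (forall p, borel (H @^-1` [set p])) ->
  simple_integral E (phi \o H) f = \sum_(p <- s) phi p *: E (H @^-1` [set p]) f.
Proof.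
move=> us Hs bH; rewrite /simple_integral.
pose u := undup (map phi s).
have -> : \sum_(z \in range (phi \o H)) z *: E ((phi \o H) @^-1` [set z]) f =
    \sum_(z <- u) z *: E ((phi \o H) @^-1` [set z]) f.
  (* [s] may list points that [H] does not attain; the additional values have empty preimage and
     contribute 0. *)
  rewrite (fsbig_widen _ [set` u]); last 2 first.
  - move=> _ [x _ <-] /=; rewrite mem_undup.
    by apply/mapP; exists (H x).
  - move=> z [_ nz] /=; rewrite (_ : _ @^-1` _ = set0).
      by rewrite (spectral0 hE) scaler0.
    by apply/seteqP; split => // x xz; apply: nz; exists x.
  by rewrite -fsbig_seq ?undup_uniq.
have pre z : E ((phi \o H) @^-1` [set z]) f =
    \sum_(p <- s | phi p == z) E (H @^-1` [set p]) f.
  rewrite -big_filter -spectral_preimage_seq ?filter_uniq//.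
  congr (E _ f); apply/seteqP; split => x /=; rewrite mem_filter Hs andbT.
    by move=> ->.
  by move/eqP.
under eq_bigr do rewrite pre scaler_sumr.
rewrite (exchange_big_dep xpredT)//= big_seq [RHS]big_seq.
apply: eq_bigr => p ps.
rewrite (eq_bigl (fun i => i == phi p)); last by move=> z; rewrite eq_sym.
rewrite -big_filter filter_pred1_uniq ?undup_uniq ?big_seq1// mem_undup.
by apply/mapP; exists p.
Qed.

Lemma simple_fun_comp (T : choiceType) (H : R[i] -> T) (phi : T -> R[i]) :
  finite_set (range H) -> (forall p, borel (H @^-1` [set p])) ->
  simple_fun (phi \o H).
Proof.
move=> fH bH; split.
  have -> : range (phi \o H) = phi @` range H by rewrite image_comp.
  exact: finite_image.
have /finite_seqP[s hs] := fH => z.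
rewrite (_ : _ @^-1` _ = [set x | H x \in [seq p <- s | phi p == z]]).
  exact: borel_preimage_seq.
apply/seteqP; split => x /=; rewrite mem_filter.
  move=> ->; rewrite eqxx/=; have : range H (H x) by exists x.
  by rewrite hs.
by move=> /andP[/eqP].
Qed.

Lemma finite_range_enum (T : choiceType) (H : R[i] -> T) :
  finite_set (range H) -> exists2 s : seq T, uniq s & forall x, H x \in s.
Proof.
move=> /finite_seqP[s hs]; exists (undup s); first exact: undup_uniq.
move=> x; rewrite mem_undup; have : range H (H x) by exists x.
by rewrite hs.
Qed.

(** The fibres of the pair form the common refinement of the partitions belonging to F and G. *)
Definition fpair F G (z : R[i]) : R[i] * R[i] := (F z, G z).

Lemma fpair_simple F G : simple_fun F -> simple_fun G ->
  finite_set (range (fpair F G)) /\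
  forall p, borel (fpair F G @^-1` [set p]).
Proof.
move=> [fF bF] [fG bG]; split.
  apply: (sub_finite_set _ (finite_setX fF fG)) => _ [x _ <-].
  by split => /=; exists x.
case=> p q; rewrite (_ : _ @^-1` _ = F @^-1` [set p] `&` G @^-1` [set q]).
  exact: borelI.
by apply/seteqP; split => x /=; [case=> -> -> | case=> <- <-].
Qed.


End SimpleIntegral.

(** * Linearity, multiplicativity and norm bound for simple integrals *)

Section SimpleIntegralAlgebra.
Variables (R : realType) (X : completeNormedModType R[i]).
Variable E : set R[i] -> {linear X -> X}.
Hypothesis hE : spectral_measure E.
Implicit Types (a b d : set R[i]) (f : X) (F G : R[i] -> R[i]).

Lemma simple_fun_pair F G (phi : R[i] * R[i] -> R[i]) :
  simple_fun F -> simple_fun G -> simple_fun (phi \o fpair F G).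
Proof. by move=> sF sG; have [fH bH] := fpair_simple sF sG; exact: simple_fun_comp. Qed.

(** One enumeration [s] serves every [phi], so F, G and their combinations become sums over the same
    index set. *)
Lemma simple_integral_pair F G : simple_fun F -> simple_fun G ->
  exists s : seq (R[i] * R[i]), [/\ uniq s,
    forall p, borel (fpair F G @^-1` [set p]) &
    forall (phi : R[i] * R[i] -> R[i]) f,
      simple_integral E (phi \o fpair F G) f =
      \sum_(p <- s) phi p *: E (fpair F G @^-1` [set p]) f].
Proof.
move=> sF sG; have [fH bH] := fpair_simple sF sG.
have [s us hs] := finite_range_enum fH; exists s; split => // phi f.
exact: simple_integral_partition.
Qed.

Lemma simple_integral_linear (c : R[i]) F G f : simple_fun F -> simple_fun G ->
  simple_integral E (fun z => c * F z + G z) f =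
  c *: simple_integral E F f + simple_integral E G f.
Proof.
move=> sF sG; have [s [us bH hs]] := simple_integral_pair sF sG.
rewrite (hs (fun p => c * p.1 + p.2) f
  : simple_integral E (fun z => c * F z + G z) f = _).
rewrite (hs fst f : simple_integral E F f = _).
rewrite (hs snd f : simple_integral E G f = _).
rewrite scaler_sumr -big_split/=; apply: eq_bigr => p _.
by rewrite scalerDl scalerA.
Qed.

(** Distinct fibres are disjoint, so their projections annihilate each other and only diagonal terms
    survive. *)
Lemma simple_integralM F G f : simple_fun F -> simple_fun G ->
  simple_integral E (fun z => F z * G z) f =
  simple_integral E F (simple_integral E G f).
Proof.
move=> sF sG; have [s [us bH hs]] := simple_integral_pair sF sG.
rewrite (hs (fun p => p.1 * p.2) f
  : simple_integral E (fun z => F z * G z) f = _).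
rewrite (hs snd f : simple_integral E G f = _).
set g := (X in simple_integral E F X); rewrite (hs fst g : simple_integral E F g = _).
rewrite big_seq [RHS]big_seq; apply: eq_bigr => p ps; rewrite -scalerA.
congr (_ *: _); rewrite /g linear_sum (bigD1_seq p)//= big1 ?addr0.
  by rewrite linearZ/= (spectral_proj hE).
move=> q qp; rewrite linearZ/= -(spectralI hE)//.
rewrite (_ : _ `&` _ = set0) ?(spectral0 hE) ?scaler0//.
by apply/seteqP; split => // x [/= xp xq]; rewrite -xp -xq eqxx in qp.
Qed.

Lemma simple_integral_vlinear F (c : R[i]) f g : simple_fun F ->
  simple_integral E F (c *: f + g) =
  c *: simple_integral E F f + simple_integral E F g.
Proof.
move=> sF; have [s [us bH hs]] := simple_integral_pair sF sF.
have hF h : simple_integral E F h =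
  \sum_(p <- s) p.1 *: E (fpair F F @^-1` [set p]) h := hs fst h.
rewrite !hF.
rewrite scaler_sumr -big_split/=; apply: eq_bigr => p _.
by rewrite linearP scalerDr !scalerA mulrC.
Qed.

(** Any subsum of the projections of the fibres is the projection of one Borel set, hence bounded by
    M; arbitrary coefficients cost the factor 4. *)
Lemma simple_integral_le : exists2 K : R, 0 < K & forall F c f,
  simple_fun F -> 0 <= c -> (forall z, rnorm (F z) <= c) ->
  rnorm (simple_integral E F f) <= K * c * rnorm f.
Proof.
have [M M0 hM] := spectral_uniformly_bounded hE.
exists (4 * M); first by rewrite mulr_gt0.
move=> F c f [fF bF] c0 Fc; have [s us hs] := finite_range_enum fF.
(* The bound for linear combinations wants all coefficients at most c, also at points that F does
   not attain. *)
pose phi (z : R[i]) : R[i] := if rnorm z <= c then z else 0.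
have -> : F = phi \o F by apply/funext => z; rewrite /= /phi Fc.
rewrite (simple_integral_partition hE _ _ us)//.
rewrite (_ : 4 * M * c * _ = 4 * c * (M * rnorm f)); last by ring.
apply: rnorm_sum_le => // [p|b].
  by rewrite /phi; case: ifP => //; rewrite rnorm0.
rewrite -big_filter -(spectral_preimage_seq hE)// ?filter_uniq//.
by apply: hM; exact: borel_preimage_seq.
Qed.

Lemma preimage_mem_bool d (p : bool) : borel d ->
  borel ((fun z => z \in d) @^-1` [set p]).
Proof.
case: p => md; [rewrite (_ : _ @^-1` _ = d)//|rewrite (_ : _ @^-1` _ = ~` d)].
- by apply/seteqP; split => x /=; [exact: set_mem|exact: mem_set].
- exact: borelC.
- apply/seteqP; split => x /=.
    by move=> /negbT; rewrite notin_setE.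
  by move=> xd; apply/negbTE; rewrite notin_setE.
Qed.

Lemma simple_integral_indic d f : borel d -> simple_integral E \1_d f = E d f.
Proof.
move=> md; have -> : \1_d = (fun b : bool => b%:R) \o (fun z => z \in d)
  :> (R[i] -> R[i]) by [].
rewrite (@simple_integral_partition _ _ _ hE _ _ [:: true; false])//; first last.
- by move=> p; exact: preimage_mem_bool.
- by move=> x; rewrite !inE; case: (x \in d).
rewrite big_cons big_seq1 /= scale1r scale0r addr0; congr (E _ f).
by apply/seteqP; split => x /=; [exact: set_mem|exact: mem_set].
Qed.

Lemma simple_fun_indic d : borel d -> simple_fun (\1_d : R[i] -> R[i]).
Proof.
move=> md.
apply: (@simple_fun_comp _ _ (fun z => z \in d) (fun b : bool => b%:R)).
  exact: finite_finset.
by move=> p; exact: preimage_mem_bool.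
Qed.

End SimpleIntegralAlgebra.

(** * Uniform approximation of bounded Borel functions *)

Section BoundedBorel.
Variable R : realType.
Implicit Types F G : R[i] -> R[i].

Definition cmeasurable F :=
  measurable_fun setT (fun z : cborel R => complex.Re (F z)) /\
  measurable_fun setT (fun z : cborel R => complex.Im (F z)).

Definition bounded_by F (c : R) := forall z, rnorm (F z) <= c.

Definition bounded_borel F := cmeasurable F /\ exists c, bounded_by F c.

Definition uniform_lim (s : nat -> R[i] -> R[i]) F :=
  forall e : R, 0 < e -> \forall n \near \oo, forall z, rnorm (s n z - F z) <= e.

Lemma borel_floor (x : R[i] -> R) (c : R) (k : int) :
  measurable_fun setT (x : cborel R -> R) ->
  borel [set z | Num.floor (c * x z) = k].
Proof.
move=> mx; rewrite (_ : [set _ | _] =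
    [set: cborel R] `&` (fun z => c * x z) @^-1` `[k%:~R, (k + 1)%:~R[%classic).
  have mcx : measurable_fun setT (fun z : cborel R => c * x z).
    exact: (@measurable_funM _ (cborel R) R setT (cst c) x
      (@measurable_cst _ _ _ _ _ _) mx).
  by apply: mcx => //; exact: measurable_itv.
apply/seteqP; split => z /=.
  by move=> <-; split => //; rewrite in_itv/= floor_le floorD1_gt.
by rewrite in_itv/= => -[_ h]; apply: floor_def.
Qed.

(** Real and imaginary parts are rounded down to multiples of 1 / (n + 1); boundedness leaves
    finitely many grid points. *)
Lemma bounded_borel_approx F : bounded_borel F ->
  exists s, (forall n, simple_fun (s n)) /\ uniform_lim s F.
Proof.
move=> [[mRe mIm] [c hc]].
pose H n z := (Num.floor (n.+1%:R * complex.Re (F z)),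
               Num.floor (n.+1%:R * complex.Im (F z))).
pose phi n (p : int * int) : R[i] :=
  (p.1%:~R / n.+1%:R) +i* (p.2%:~R / n.+1%:R).
exists (fun n => phi n \o H n); split => [n|e e0].
  apply: simple_fun_comp; last first.
    case=> k l; rewrite (_ : _ @^-1` _ =
      [set z | Num.floor (n.+1%:R * complex.Re (F z)) = k] `&`
      [set z | Num.floor (n.+1%:R * complex.Im (F z)) = l]).
      by apply: borelI; exact: borel_floor.
    by apply/seteqP; split => z /=; [case=> -> ->|case=> <- <-].
  have fin (x : R[i] -> R) : (forall z, `|x z| <= c) ->
      finite_set (range (fun z => Num.floor (n.+1%:R * x z))).
    (* The scaled value has modulus below N + 1, so its floor is one of the 2 (N + 1) integers from
       -(N + 1) to N. *)
    move=> hx; pose N := Num.truncn (n.+1%:R * c).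
    apply: (@sub_finite_set _ _ [set` [seq k%:Z - N.+1%:Z | k <- iota 0 (N.+1 + N.+1)]]);
      last exact: finite_seq.
    move=> _ [z _ <-]; rewrite -[_ _]/(is_true (_ \in _)); set y := n.+1%:R * x z.
    have yN : `|y| < N.+1%:R.
      apply: le_lt_trans (truncnS_gt _).
      by rewrite normrM ger0_norm// ler_wpM2l.
    move: yN; rewrite ltr_norml => /andP[y1 y2].
    have f1 : - N.+1%:Z <= Num.floor y.
      by rewrite floor_ge_int rmorphN/= ltW.
    have f2 : Num.floor y < N.+1%:Z by rewrite floor_lt_int.
    apply/mapP; exists (`|(Num.floor y + N.+1%:Z)%R|%N).
      by rewrite mem_iota /= add0n; lia.
    by lia.
  apply: (sub_finite_set _ (finite_setX (fin (fun z => complex.Re (F z)) _)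
                                        (fin (fun z => complex.Im (F z)) _))).
  - by move=> _ [z _ <-]; split => /=; exists z.
  - by move=> z; apply: le_trans (hc z); exact: Re_le_rnorm.
  - by move=> z; apply: le_trans (hc z); exact: Im_le_rnorm.
have near_floor n (y : R) :
    `|(Num.floor (n.+1%:R * y))%:~R / n.+1%:R - y| <= n.+1%:R^-1.
  have := floor_le (n.+1%:R * y); have := floorD1_gt (n.+1%:R * y).
  rewrite intrD; set k := (_%:~R) => h1 h2.
  rewrite ler_norml lerBrDr lerBlDr addrC.
  rewrite -(ler_pM2l (ltr0Sn R n)) -[X in _ && X](ler_pM2l (ltr0Sn R n)).
  rewrite mulrBr mulrDr mulfV ?pnatr_eq0// [_ * (k / _)]mulrC divfK ?pnatr_eq0//.
  by apply/andP; split; lra.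
have [N _ hN] : \forall n \near \oo, n.+1%:R^-1 < e / 2 :> R.
  by apply: (cvgr_lt 0); [exact: cvg_harmonic|rewrite divr_gt0].
exists N => // n Nn z; rewrite (le_trans (rnorm_le_ReIm _))//.
rewrite (splitr e) lerD//; apply: le_trans (ltW (hN n Nn)); rewrite /phi /=.
  by have := near_floor n (complex.Re (F z)); case: (F z).
by have := near_floor n (complex.Im (F z)); case: (F z).
Qed.

End BoundedBorel.

(** * Existence, independence of the approximation, and bounds for bounded integrals *)

Section BoundedIntegral.
Variables (R : realType) (X : completeNormedModType R[i]).
Variable E : set R[i] -> {linear X -> X}.
Hypothesis hE : spectral_measure E.
Implicit Types (d : set R[i]) (f g : X) (F G : R[i] -> R[i])
  (s : nat -> R[i] -> R[i]).

Lemma simple_integral_dist : exists2 K : R, 0 < K & forall F G c f,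
  simple_fun F -> simple_fun G -> 0 <= c ->
  (forall z, rnorm (F z - G z) <= c) ->
  rnorm (simple_integral E F f - simple_integral E G f) <= K * c * rnorm f.
Proof.
have [K K0 hK] := simple_integral_le hE; exists K => // F G c f sF sG c0 FG.
have := simple_integral_linear hE (-1) f sG sF.
rewrite scaleN1r addrC => <-; apply: hK => //; last first.
  by move=> z; rewrite mulN1r addrC.
exact: (simple_fun_pair (fun p => -1 * p.1 + p.2) sG sF).
Qed.

Lemma uniform_lim_dist s s' F (e : R) : uniform_lim s F -> uniform_lim s' F ->
  0 < e -> exists N, forall n m, (N <= n)%N -> (N <= m)%N ->
    forall z, rnorm (s n z - s' m z) <= e.
Proof.
move=> sF sF' e0; have e2 : 0 < e / 2 by rewrite divr_gt0.
have [N1 _ h1] := sF _ e2; have [N2 _ h2] := sF' _ e2.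
exists (maxn N1 N2) => n m; rewrite !geq_max => /andP[n1 _] /andP[_ m2] z.
rewrite -[s n z](subrK (F z)) -addrA (le_trans (rnormD _ _))// (splitr e).
by rewrite lerD//; [exact: h1|rewrite rdistC; exact: h2].
Qed.

(** The simple integrals are Cauchy in operator norm. Their pointwise limit is linear, and the
    uniform rate survives the limit and yields continuity. *)
Lemma is_bounded_integral_exists s F :
  (forall n, simple_fun (s n)) -> uniform_lim s F ->
  exists T, is_bounded_integral E F T.
Proof.
move=> ss sF; have [K K0 hK] := simple_integral_dist.
have [K' K'0 hK'] := simple_integral_le hE.
have cauchy (e : R) : 0 < e -> exists N, forall n m, (N <= n)%N ->
    (N <= m)%N -> forall f, rnorm (simple_integral E (s n) f -
      simple_integral E (s m) f) <= e * rnorm f.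
  move=> e0; have [N hN] := uniform_lim_dist sF sF (divr_gt0 e0 K0).
  exists N => n m Nn Nm f.
  rewrite (le_trans (hK _ _ (e / K) f (ss n) (ss m) _ (hN _ _ Nn Nm)))//.
    by rewrite divr_ge0// ltW.
  by rewrite mulrC [K * _]mulrC divfK ?gt_eqF// mulrC.
have cv f : cvg ((fun n => simple_integral E (s n) f) @ \oo).
  apply: rnorm_cauchy_cvg => e e0.
  have f1 : 0 < rnorm f + 1 by rewrite ltr_wpDl ?rnorm_ge0.
  have [N hN] := cauchy _ (divr_gt0 e0 f1); exists N => n m Nn Nm.
  rewrite (le_trans (hN _ _ Nn Nm f))// mulrAC ler_pdivrMr//.
  by rewrite ler_pM2l// lerDl.
pose T f : X := lim ((fun n => simple_integral E (s n) f) @ \oo).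
have Tlin : linear T.
  move=> a f g; rewrite /T.
  under eq_fun do rewrite (simple_integral_vlinear hE)//.
  apply: cvg_lim; first exact: norm_hausdorff.
  by apply: cvgD; [apply: cvgZr|]; exact: cv.
pose pT : {linear X -> X} := HB.pack T (GRing.isLinear.Build _ _ _ _ _ Tlin).
have Tdist (e : R) : 0 < e -> exists N, forall n, (N <= n)%N -> forall f,
    rnorm (simple_integral E (s n) f - pT f) <= e * rnorm f.
  move=> /cauchy[N hN]; exists N => n Nn f.
  apply: (@rnorm_lim_le _ _ _ \oo _ (fun m => simple_integral E (s n) f -
    simple_integral E (s m) f)).
    by apply: cvgB; [exact: cvg_cst|exact: cv].
  by exists N => // m Nm; exact: hN.
exists pT; split.
  have [N hN] := Tdist 1 ltr01.
  have [c c0 hc] : exists2 c, 0 <= c & forall z, rnorm (s N z) <= c.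
    have [t _ ht] := finite_range_enum (ss N).1.
    exists (\sum_(p <- t) rnorm p); first by rewrite sumr_ge0// => *; exact: rnorm_ge0.
    move=> z; rewrite (big_rem _ (ht z))/= lerDl sumr_ge0// => *; exact: rnorm_ge0.
  apply: (@linear_rnorm_continuous _ _ _ (1 + K' * c)) => f.
  rewrite -[pT f](subrK (simple_integral E (s N) f)) (le_trans (rnormD _ _))//.
  by rewrite mulrDl lerD// ?hK'// rdistC hN.
exists s; split => // e /gt0_complexP[r r0 ->].
  by have := sF _ r0; apply: filterS => n hn z; rewrite ler_rnorm.
have [N hN] := Tdist _ r0; exists N => // n Nn f.
by rewrite -!rnormE -rmorphM lecR hN.
Qed.

(** The chosen operator comes with an approximating sequence of its own; comparing it with [s]
    allows any approximation to be used afterwards. *)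
Lemma bounded_integral_lim s F : (forall n, simple_fun (s n)) ->
  uniform_lim s F ->
  forall e : R, 0 < e -> \forall n \near \oo, forall f,
    rnorm (simple_integral E (s n) f - bounded_integral E F f) <= e * rnorm f.
Proof.
move=> ss sF e e0; have [T hT] := is_bounded_integral_exists ss sF.
have /= := @xgetPex {classic {linear X -> X}} (\0 : {classic {linear X -> X}})
  (is_bounded_integral E F) (ex_intro _ T hT).
rewrite -/(bounded_integral E F); set I := bounded_integral E F.
move=> [_ [s' [ss' sF' lim']]].
have {}sF' : uniform_lim s' F.
  move=> r r0; have := sF' r%:C; rewrite ltcR => /(_ r0).
  by apply: filterS => n hn z; rewrite -ler_rnorm.
have [K K0 hK] := simple_integral_dist.
have e2 : 0 < e / 2 by rewrite divr_gt0.
have [N1 hN1] := uniform_lim_dist sF sF' (divr_gt0 e2 K0).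
have [|N2 _ hN2] := lim' (e / 2)%:C; first by rewrite ltcR.
exists N1 => // n n1 f; pose m := maxn N1 N2.
rewrite -[X in rnorm (X - _)](subrK (simple_integral E (s' m) f)) -addrA.
rewrite (le_trans (rnormD _ _))// (splitr e) mulrDl lerD//.
  apply: (le_trans (hK _ _ (e / 2 / K) f (ss n) (ss' m) _ _)).
  - by rewrite !divr_ge0// ltW.
  - by apply: hN1 => //; exact: leq_maxl.
  - by rewrite [K * _]mulrC divfK ?gt_eqF.
by have := hN2 m (leq_maxr _ _) f; rewrite -!rnormE -rmorphM lecR.
Qed.

Lemma eq_rnorm_small (x y : X) (c : R) : 0 <= c ->
  (forall e : R, 0 < e -> rnorm (x - y) <= e * c) -> x = y.
Proof.
move=> c0 h; apply/subr0_eq/rnorm_le0/ler_addgt0Pr => e e0.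
have c1 : 0 < c + 1 by rewrite ltr_wpDl.
rewrite add0r (le_trans (h _ (divr_gt0 e0 c1)))// mulrAC ler_pdivrMr//.
by rewrite ler_pM2l// lerDl.
Qed.

Lemma bounded_integral_simple F f : simple_fun F ->
  bounded_integral E F f = simple_integral E F f.
Proof.
move=> sF; apply/esym/(@eq_rnorm_small _ _ (rnorm f)); first exact: rnorm_ge0.
move=> e e0; have uF : uniform_lim (fun=> F) F.
  by move=> r r0; near=> n => z; rewrite subrr rnorm0 ltW.
by have [n _ /(_ n (leqnn n))] := bounded_integral_lim (fun=> sF) uF e0; exact.
Unshelve. all: by end_near. Qed.

Lemma bounded_integral_indic d f : borel d ->
  bounded_integral E \1_d f = E d f.
Proof.
move=> md; rewrite bounded_integral_simple; first exact: simple_integral_indic.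
exact: simple_fun_indic.
Qed.

Lemma bounded_integral_le : exists2 K : R, 0 < K & forall F c f,
  bounded_borel F -> 0 <= c -> bounded_by F c ->
  rnorm (bounded_integral E F f) <= K * c * rnorm f.
Proof.
have [K K0 hK] := simple_integral_le hE; exists K => // F c f bF c0 Fc.
have [s [ss sF]] := bounded_borel_approx bF.
apply/ler_addgt0Pr => e e0.
have f1 : 0 < (K + 1) * (rnorm f + 1).
  by rewrite mulr_gt0// ltr_wpDl ?rnorm_ge0// ltW.
(* The errors amount to r (K + 1) |f|: K from the enlarged sup bound c + r, 1 from the integral. The
   1 added to |f| keeps the denominator positive. *)
set r := e / ((K + 1) * (rnorm f + 1)); have r0 : 0 < r by rewrite divr_gt0.
have [n [h1 h2]] := filter_ex (filterI (bounded_integral_lim ss sF r0) (sF _ r0)).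
have h3 : rnorm (simple_integral E (s n) f) <= K * (c + r) * rnorm f.
  apply: hK => //; first by rewrite addr_ge0// ltW.
  by move=> z; rewrite -(subrK (F z) (s n z)) (le_trans (rnormD _ _))// addrC lerD.
have := rnormB (simple_integral E (s n) f)
  (simple_integral E (s n) f - bounded_integral E F f).
rewrite opprB addrCA subrr addr0 => h4.
have e_def : e = r * ((K + 1) * (rnorm f + 1)) by rewrite divfK ?lt0r_neq0.
by have := h1 f; rewrite e_def; have := rnorm_ge0 f; nra.
Qed.

Lemma bounded_integral_continuous F : bounded_borel F ->
  continuous (bounded_integral E F).
Proof.
move=> bF; have [_ [c hc]] := bF; have [K K0 hK] := bounded_integral_le.
apply: (@linear_rnorm_continuous _ _ _ (K * c)) => f; apply: hK => //.
by apply: le_trans (hc 0); exact: rnorm_ge0.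
Qed.

Lemma bounded_integral_linear (a : R[i]) F G f :
  bounded_borel F -> bounded_borel G ->
  bounded_integral E (fun z => a * F z + G z) f =
  a *: bounded_integral E F f + bounded_integral E G f.
Proof.
move=> bF bG; have [s [ss sF]] := bounded_borel_approx bF.
have [t [st tG]] := bounded_borel_approx bG.
have su n : simple_fun (fun z => a * s n z + t n z).
  exact: (simple_fun_pair (fun p => a * p.1 + p.2) (ss n) (st n)).
have a1 : 0 < rnorm a + 1 by rewrite ltr_wpDl ?rnorm_ge0.
have un : uniform_lim (fun n z => a * s n z + t n z) (fun z => a * F z + G z).
  move=> e e0; set r := e / (rnorm a + 1).
  have r0 : 0 < r by rewrite divr_gt0.
  apply: filterS2 (sF _ r0) (tG _ r0) => n h1 h2 z.
  rewrite opprD addrACA -mulrBr (le_trans (rnormD _ _))// rnormM.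
  rewrite -[e](divfK (lt0r_neq0 a1)) -/r mulrDr mulr1 mulrC lerD//.
  by rewrite ler_wpM2r ?rnorm_ge0.
apply: (@eq_rnorm_small _ _ (rnorm f * (rnorm a + 2))) => [|e e0].
  by rewrite mulr_ge0 ?addr_ge0 ?rnorm_ge0.
have [n [h1 [h2 h3]]] := filter_ex (filterI (bounded_integral_lim su un e0)
  (filterI (bounded_integral_lim ss sF e0) (bounded_integral_lim st tG e0))).
have {h1}:= h1 f; have {h2}:= h2 f; have {h3} := h3 f.
rewrite (simple_integral_linear hE)//.
set x := bounded_integral E _ f; set y := bounded_integral E _ f.
set z := bounded_integral E _ f; set u := simple_integral _ _ _.
set v := simple_integral _ _ _ => h1 h2 h3.
have -> : z - (a *: y + x) = a *: (v - y) + (u - x) - (a *: v + u - z).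
  by rewrite scalerBr addrACA -opprD opprB [RHS]addrC addrA subrK.
rewrite (le_trans (rnormB _ _))//.
have := rnormD (a *: (v - y)) (u - x); rewrite rnormZ.
by have := rnorm_ge0 a; nra.
Qed.

End BoundedIntegral.

(** * Closure properties of Borel functions *)

Section BorelFunctions.
Variable R : realType.
Implicit Types (F G : R[i] -> R[i]) (d : set R[i]).

Lemma cmeasurable_cst (c : R[i]) : cmeasurable (fun=> c).
Proof. by split; exact: measurable_cst. Qed.

Lemma open_complexP (O : set (R[i] : numFieldType)) :
  (forall x : R[i], O x -> exists2 r : R, 0 < r &
    forall y, rnorm (x - y) < r -> O y) -> open O.
Proof. by move=> h; apply/(@open_rnormP _ R[i]^o). Qed.

Lemma cmeasurable_id : cmeasurable (@id R[i]).
Proof.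
split; apply: (measurability _ (RGenOInfty.measurableE R)) => //;
  move=> _ [_ [a ->] <-]; rewrite setTI; apply: borel_open; apply: open_complexP;
  move=> x /=; rewrite in_itv/= andbT => ax.
- exists (complex.Re x - a) => [|y hy]; first by rewrite subr_gt0.
  rewrite /= in_itv/= andbT; have := le_lt_trans (Re_le_rnorm _) hy.
  rewrite ltr_norml => /andP[_]; case: x y {ax hy} => [x1 x2] [y1 y2] /=; lra.
- exists (complex.Im x - a) => [|y hy]; first by rewrite subr_gt0.
  rewrite /= in_itv/= andbT; have := le_lt_trans (Im_le_rnorm _) hy.
  rewrite ltr_norml => /andP[_]; case: x y {ax hy} => [x1 x2] [y1 y2] /=; lra.
Qed.

Lemma cmeasurableD F G : cmeasurable F -> cmeasurable G ->
  cmeasurable (fun z => F z + G z).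
Proof.
move=> [F1 F2] [G1 G2]; split.
  rewrite (_ : (fun _ => _) = (fun z => complex.Re (F z)) \+
    (fun z => complex.Re (G z))); first exact: (measurable_funD F1 G1).
  by apply/funext => z /=; case: (F z) (G z) => [? ?] [].
rewrite (_ : (fun _ => _) = (fun z => complex.Im (F z)) \+
  (fun z => complex.Im (G z))); first exact: (measurable_funD F2 G2).
by apply/funext => z /=; case: (F z) (G z) => [? ?] [].
Qed.

Lemma cmeasurableM F G : cmeasurable F -> cmeasurable G ->
  cmeasurable (fun z => F z * G z).
Proof.
move=> [F1 F2] [G1 G2]; split.
  rewrite (_ : (fun _ => _) = ((fun z => complex.Re (F z)) \*
    (fun z => complex.Re (G z))) \- ((fun z => complex.Im (F z)) \*
    (fun z => complex.Im (G z)))).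
    exact: (measurable_funB (measurable_funM F1 G1) (measurable_funM F2 G2)).
  by apply/funext => z /=; case: (F z) (G z) => [? ?] [].
rewrite (_ : (fun _ => _) = ((fun z => complex.Re (F z)) \*
  (fun z => complex.Im (G z))) \+ ((fun z => complex.Im (F z)) \*
  (fun z => complex.Re (G z)))).
  exact: (measurable_funD (measurable_funM F1 G2) (measurable_funM F2 G1)).
by apply/funext => z /=; case: (F z) (G z) => [? ?] [].
Qed.

Lemma cmeasurableX F n : cmeasurable F -> cmeasurable (fun z => F z ^+ n).
Proof.
move=> mF; elim: n => [|n IH]; first exact: cmeasurable_cst.
by under eq_fun do rewrite exprS; exact: cmeasurableM.
Qed.

Lemma cmeasurable_indic d : borel d -> cmeasurable (\1_d : R[i] -> R[i]).
Proof.
move=> md; split.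
  rewrite (_ : (fun _ => _) = (\1_d : cborel R -> R)).
    exact: measurable_indic.
  by apply/funext => z; rewrite /indic; case: (z \in d).
rewrite (_ : (fun _ => _) = cst 0); first exact: measurable_cst.
by apply/funext => z; rewrite /indic; case: (z \in d).
Qed.

Lemma measurable_sqr_sum F : cmeasurable F ->
  measurable_fun setT (fun z : cborel R =>
    complex.Re (F z) ^+ 2 + complex.Im (F z) ^+ 2).
Proof.
by move=> [F1 F2]; apply: (measurable_funD (measurable_funX 2 F1)
  (measurable_funX 2 F2)).
Qed.

Lemma cmeasurableV F : cmeasurable F -> cmeasurable (fun z => (F z)^-1).
Proof.
move=> mF; have mS := measurable_sqr_sum mF; case: mF => F1 F2.
pose S z := complex.Re (F z) ^+ 2 + complex.Im (F z) ^+ 2.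
(* The reciprocal is read as the power -1; both are 0 at 0, so zeros of F need no separate case. *)
have mSV : measurable_fun setT (fun z : cborel R => (S z)^-1).
  rewrite (_ : (fun _ => _) = (fun x => x `^ (-1)) \o S).
    exact: (measurableT_comp (measurable_powR (-1)) mS).
  apply/funext => z /=; rewrite powR_inv1//.
  by rewrite /S addr_ge0// sqr_ge0.
split.
  rewrite (_ : (fun _ => _) = (fun z => complex.Re (F z)) \* (fun z => (S z)^-1)).
    exact: (measurable_funM F1 mSV).
  by apply/funext => z /=; rewrite /S; case: (F z).
rewrite (_ : (fun _ => _) = (fun z => - complex.Im (F z)) \* (fun z => (S z)^-1)).
  exact: (measurable_funM (measurable_funN F2) mSV).
by apply/funext => z /=; rewrite /S mulNr; case: (F z).
Qed.

Lemma cmeasurable_cexp F : cmeasurable F -> cmeasurable (fun z => cexp (F z)).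
Proof.
move=> [F1 F2].
have me := measurableT_comp (@measurable_expR R) F1.
have mc := measurableT_comp (continuous_measurable_fun (@continuous_cos R)) F2.
have ms := measurableT_comp (continuous_measurable_fun (@continuous_sin R)) F2.
split.
  rewrite (_ : (fun _ => _) = (expR \o (fun z => complex.Re (F z))) \*
    (cos \o (fun z => complex.Im (F z)))); first exact: (measurable_funM me mc).
  by apply/funext => z /=; rewrite mul0r subr0.
rewrite (_ : (fun _ => _) = (expR \o (fun z => complex.Re (F z))) \*
  (sin \o (fun z => complex.Im (F z)))); first exact: (measurable_funM me ms).
by apply/funext => z /=; rewrite mul0r addr0.
Qed.

Lemma borel_rnorm_le F (c : R) : cmeasurable F -> borel [set z | rnorm (F z) <= c].
Proof.
move=> mF; have mS : measurable_fun setT (fun z : cborel R => rnorm (F z)).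
  rewrite (_ : (fun _ => _) = @Num.sqrt R \o (fun z =>
    complex.Re (F z) ^+ 2 + complex.Im (F z) ^+ 2)).
    apply: (measurableT_comp _ (measurable_sqr_sum mF)).
    by apply: continuous_measurable_fun; exact: sqrt_continuous.
  by apply/funext => z /=; rewrite rnorm_sqrt.
rewrite (_ : [set _ | _] =
  [set: cborel R] `&` (fun z => rnorm (F z)) @^-1` `]-oo, c]%classic).
  by apply: mS => //; exact: measurable_itv.
by rewrite setTI; apply/seteqP; split => z /=; rewrite in_itv.
Qed.

Lemma borel_Re_le (c : R) : borel [set z | complex.Re z <= c].
Proof.
have [mRe _] := cmeasurable_id.
rewrite (_ : [set _ | _] =
  [set: cborel R] `&` (fun z => complex.Re z) @^-1` `]-oo, c]%classic).
  by apply: mRe => //; exact: measurable_itv.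
by rewrite setTI; apply/seteqP; split => z /=; rewrite in_itv.
Qed.

Lemma rnorm_indic d (z : R[i]) : rnorm (\1_d z : R[i]) = \1_d z.
Proof. by rewrite /indic; case: (z \in d); rewrite ?rnorm1 ?rnorm0. Qed.

Lemma rnorm_indic_le1 d (z : R[i]) : rnorm (\1_d z : R[i]) <= 1.
Proof. by rewrite rnorm_indic /indic; case: (z \in d). Qed.

Lemma bounded_borel_indic d : borel d -> bounded_borel (\1_d : R[i] -> R[i]).
Proof.
move=> md; split; first exact: cmeasurable_indic.
by exists 1 => z; exact: rnorm_indic_le1.
Qed.

Lemma bounded_borelM F G : bounded_borel F -> bounded_borel G ->
  bounded_borel (fun z => F z * G z).
Proof.
move=> [mF [c hc]] [mG [c' hc']]; split; first exact: cmeasurableM.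
exists (c * c') => z; rewrite rnormM ler_pM ?rnorm_ge0//.
Qed.

Lemma bounded_borelB F G : bounded_borel F -> bounded_borel G ->
  bounded_borel (fun z => F z - G z).
Proof.
move=> [mF [c hc]] [mG [c' hc']]; split.
  have -> : (fun z => F z - G z) = (fun z => F z + -1 * G z).
    by apply/funext => z; rewrite mulN1r.
  by apply: cmeasurableD => //; apply: cmeasurableM => //; exact: cmeasurable_cst.
by exists (c + c') => z; rewrite (le_trans (rnormB _ _))// lerD.
Qed.

Lemma bounded_by_indicP F d (c : R) : 0 <= c ->
  (forall z, d z -> rnorm (F z) <= c) -> bounded_by (fun z => F z * \1_d z) c.
Proof.
move=> c0 h z; rewrite rnormM rnorm_indic /indic.
have [/set_mem zd|_] := boolP (z \in d); last by rewrite mulr0.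
by rewrite mulr1; exact: h.
Qed.

Lemma bounded_borel_on F d (c : R) : cmeasurable F -> borel d -> 0 <= c ->
  (forall z, d z -> rnorm (F z) <= c) -> bounded_borel (fun z => F z * \1_d z).
Proof.
move=> mF md c0 h; split; last by exists c; exact: bounded_by_indicP.
by apply: cmeasurableM => //; exact: cmeasurable_indic.
Qed.

Lemma truncation_setE F n :
  [set w | `|F w| <= n%:R] = [set w | rnorm (F w) <= n%:R].
Proof.
by apply/seteqP; split => z /=; rewrite -(rmorph_nat (real_complex R)) ler_rnorm.
Qed.

Lemma bounded_borel_truncation F n : cmeasurable F ->
  bounded_borel (truncation F n).
Proof.
move=> mF; rewrite /truncation truncation_setE.
by apply: (bounded_borel_on (c := n%:R)) => //; exact: borel_rnorm_le.
Qed.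

End BorelFunctions.

(** * The multiplicative calculus and its extension to unbounded functions *)

Section FunctionalCalculus.
Variables (R : realType) (X : completeNormedModType R[i]).
Variable E : set R[i] -> {linear X -> X}.
Hypothesis hE : spectral_measure E.
Implicit Types (d : set R[i]) (f g : X) (F G H : R[i] -> R[i]).

Lemma bounded_integralM F G f : bounded_borel F -> bounded_borel G ->
  bounded_integral E (fun z => F z * G z) f =
  bounded_integral E F (bounded_integral E G f).
Proof.
move=> bF bG; have [s [ss sF]] := bounded_borel_approx bF.
have [t [st tG]] := bounded_borel_approx bG.
have [_ [c hc]] := bF; have [_ [c' hc']] := bG.
have c0 : 0 <= c := le_trans (rnorm_ge0 _) (hc 0).
have c'0 : 0 <= c' := le_trans (rnorm_ge0 _) (hc' 0).
have [K K0 hK] := bounded_integral_le hE.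
have [K' K'0 hK'] := simple_integral_le hE.
have su n : simple_fun (fun z => s n z * t n z).
  exact: (simple_fun_pair (fun p => p.1 * p.2) (ss n) (st n)).
have tb : \forall n \near \oo, forall z, rnorm (t n z) <= c' + 1.
  apply: filterS (tG _ ltr01) => n h z.
  by rewrite -(subrK (G z) (t n z)) (le_trans (rnormD _ _))// addrC lerD.
have un : uniform_lim (fun n z => s n z * t n z) (fun z => F z * G z).
  move=> e e0; have d1 : 0 < c + c' + 1 by lra.
  set r := e / (c + c' + 1); have r0 : 0 < r by rewrite divr_gt0.
  have er : e = r * (c + c' + 1) by rewrite divfK ?lt0r_neq0.
  apply: filterS3 (sF _ r0) (tG _ r0) tb => n h1 h2 h3 z.
  have -> : s n z * t n z - F z * G z =
      (s n z - F z) * t n z + F z * (t n z - G z).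
    by rewrite mulrBl mulrBr addrA subrK.
  rewrite (le_trans (rnormD _ _))// !rnormM.
  have := h1 z; have := h2 z; have := h3 z; have := hc z.
  have := rnorm_ge0 (t n z); have := rnorm_ge0 (F z).
  have := rnorm_ge0 (s n z - F z); have := rnorm_ge0 (t n z - G z).
  rewrite er; nra.
(* The summands account for the product, for F approximated at the simple integral [v] of norm at
   most K' (c' + 1) |f|, and for F applied to the error v - J. *)
apply: (@eq_rnorm_small _ _ _ _ (rnorm f * (1 + K' * (c' + 1) + K * c))) => [|e e0].
  by rewrite mulr_ge0 ?rnorm_ge0// !addr_ge0// mulr_ge0 ?addr_ge0// ltW.
have [n [h1 [h2 [h3 h4]]]] := filter_ex
  (filterI (bounded_integral_lim hE su un e0)
  (filterI (bounded_integral_lim hE ss sF e0)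
  (filterI (bounded_integral_lim hE st tG e0) tb))).
have {h1} := h1 f; have {h2} := h2 (simple_integral E (t n) f).
have {h3} := h3 f; rewrite (simple_integralM hE)//.
have h5 := hK' _ (c' + 1) f (st n) (addr_ge0 c'0 ler01) h4.
set I := bounded_integral E (fun z => F z * G z) f.
set J := bounded_integral E G f.
set u := simple_integral E (s n) _; set v := simple_integral E (t n) f => h3 h2 h1.
have h6 := hK F c (v - J) bF c0 hc.
have -> : I - bounded_integral E F J =
    (u - bounded_integral E F v) + bounded_integral E F (v - J) - (u - I).
  by rewrite linearB/= addrA subrK opprB [RHS]addrC addrA subrK.
rewrite (le_trans (rnormB _ _))//.
have h7 := rnormD (u - bounded_integral E F v) (bounded_integral E F (v - J)).
have h8 : e * rnorm v <= e * (K' * (c' + 1) * rnorm f) by rewrite ler_pM2l.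
have h9 : K * c * rnorm (v - J) <= K * c * (e * rnorm f).
  by rewrite ler_wpM2l// mulr_ge0// ltW.
lra.
Qed.

Lemma bounded_integralC F G f : bounded_borel F -> bounded_borel G ->
  bounded_integral E F (bounded_integral E G f) =
  bounded_integral E G (bounded_integral E F f).
Proof.
move=> bF bG; rewrite -!bounded_integralM//.
by congr (bounded_integral E _ f); apply/funext => z; rewrite mulrC.
Qed.

Lemma bounded_integralB F G f : bounded_borel F -> bounded_borel G ->
  bounded_integral E (fun z => F z - G z) f =
  bounded_integral E F f - bounded_integral E G f.
Proof.
move=> bF bG; rewrite -[in RHS]scaleN1r addrC -(bounded_integral_linear hE)//.
by congr (bounded_integral E _ f); apply/funext => z; rewrite mulN1r addrC.
Qed.

(* Says that f is in the domain of G(A) and G(A) f = g, through the bounded part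
   of the calculus only. *)
Definition integrates G f g := forall H, bounded_borel H ->
  bounded_borel (fun z => H z * G z) ->
  bounded_integral E H g = bounded_integral E (fun z => H z * G z) f.

Lemma bounded_integrates G f : bounded_borel G ->
  integrates G f (bounded_integral E G f).
Proof. by move=> bG H bH _; rewrite bounded_integralM. Qed.

(** These sets exhaust the plane and G is bounded on each, so identities about an unbounded G can be
    checked there and passed to the limit. *)
Lemma spectral_rnorm_le_cvg G f : cmeasurable G ->
  (fun n => E [set w | rnorm (G w) <= n%:R] f) @ \oo --> f.
Proof.
move=> mG; apply: (spectral_incr_cvg hE) => [n|n z /=|].
- exact: borel_rnorm_le.
- by move=> h; apply: le_trans h _; rewrite ler_nat.
- apply/seteqP; split => // z _; exists (Num.truncn (rnorm (G z))).+1 => //=.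
  by rewrite ltW// truncnS_gt.
Qed.

(** Applied to the truncated integral of f, H(A) gives the part of (H G)(A) f on {|G| <= n}, which
    tends to (H G)(A) f. *)
Lemma integrates_dom G f : cmeasurable G -> dom (spectral_integral E G) f ->
  integrates G f (spectral_integral E G f).
Proof.
move=> mG /= cf H bH bHG.
have h1 : (fun n => bounded_integral E H (integral_seq E G f n)) @ \oo -->
    bounded_integral E H (lim (integral_seq E G f @ \oo)).
  by apply: (cvg_comp _ _ cf); exact: bounded_integral_continuous.
apply: (cvg_unique _ h1); first exact: norm_hausdorff.
have := @spectral_rnorm_le_cvg _ (bounded_integral E (fun z => H z * G z) f) mG.
apply: cvg_trans; apply: near_eq_cvg; near=> n.
have mT := borel_rnorm_le n%:R mG.
rewrite /integral_seq -bounded_integralM//; last exact: bounded_borel_truncation.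
rewrite -(bounded_integral_indic hE)// -bounded_integralM//; last first.
  exact: bounded_borel_indic.
congr (bounded_integral E _ f); apply/funext => z.
by rewrite /truncation truncation_setE; ring.
Unshelve. all: by end_near. Qed.

(** The test functions are the indicators of {|G| <= n}: they identify the truncated integrals of f
    with projections of g, which tend to g. *)
Lemma integrates_eq G f g : cmeasurable G -> integrates G f g ->
  dom (spectral_integral E G) f /\ spectral_integral E G f = g.
Proof.
move=> mG hfg.
have h : integral_seq E G f @ \oo --> g.
  have := @spectral_rnorm_le_cvg _ g mG.
  apply: cvg_trans; apply: near_eq_cvg; near=> n.
  have mT := borel_rnorm_le n%:R mG.
  have e : (fun z => \1_[set w | rnorm (G w) <= n%:R] z * G z) = truncation G n.
    by apply/funext => z; rewrite /truncation truncation_setE mulrC.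
  rewrite -(bounded_integral_indic hE)// hfg.
  - by rewrite e.
  - exact: bounded_borel_indic.
  - by rewrite e; exact: bounded_borel_truncation.
split; first exact: cvgP h.
by apply: cvg_lim h; exact: norm_hausdorff.
Unshelve. all: by end_near. Qed.

(* The orbit stays away from 0 if the part of f on which the functions are
   large is nonzero, and is bounded otherwise. *)
Lemma integrates_orbit_not_dense (I : Type) (J : set I) (G : I -> R[i] -> R[i])
    (O : I -> X) d f : f != 0 -> borel d ->
  (forall j, J j -> cmeasurable (G j)) ->
  (forall j z, J j -> d z -> 1 <= rnorm (G j z)) ->
  (forall j z, J j -> ~ d z -> rnorm (G j z) <= 1) ->
  (forall j, J j -> integrates (G j) f (O j)) ->
  ~ dense [set O j | j in J].
Proof.
move=> f0 md mG Gge1 Gle1 hO hd; have [K K0 hK] := bounded_integral_le hE.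
have fp := rnorm_gt0 f0.
have [Ef0|Ef0] := eqVneq (E d f) 0.
  (* The orbit will lie in the closed ball of radius r, whose exterior is open, and nonempty because
     f spans arbitrarily long vectors. *)
  pose r := K * rnorm f.
  have r0 : 0 < r by rewrite mulr_gt0.
  have oO : open [set x : X | r < rnorm x].
    apply/open_rnormP => x /= rx; exists (rnorm x - r); first by rewrite subr_gt0.
    by move=> y hy; have := rnormD (x - y) y; rewrite subrK; lra.
  have [|y [/= hy [j Jj Oy]]] := hd _ _ oO.
    exists (((r + 1) / rnorm f)%:C *: f) => /=.
    rewrite rnormZ rnormC ger0_norm ?divr_ge0 ?addr_ge0 ?(ltW r0) ?(ltW fp)//.
    by rewrite divfK ?gt_eqF// ltrDl.
  move: hy; rewrite -Oy; apply/negP; rewrite -leNgt.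
  (* G j may be unbounded on d. On the part of d where |G j| <= n the calculus lets E d act on f
     first, and n then tends to infinity. *)
  have Ed0 : E d (O j) = 0.
    have h1 := @spectral_rnorm_le_cvg _ (E d (O j)) (mG _ Jj).
    apply: (cvg_unique _ h1); first exact: norm_hausdorff.
    apply: cvg_near_cst; near=> n.
    set t := [set w | rnorm (G j w) <= n%:R].
    have mt : borel t by exact: borel_rnorm_le (mG _ Jj).
    have mdt : borel (t `&` d) by exact: borelI.
    rewrite -(spectralI hE)// -(bounded_integral_indic hE)// (hO _ Jj); first last.
    - under eq_fun do rewrite mulrC.
      apply: (bounded_borel_on (c := n%:R)) => //; first exact: mG.
      by move=> z [].
    - exact: bounded_borel_indic.
    have -> : (fun z => \1_(t `&` d) z * G j z) =
        (fun z => (G j z * \1_t z) * \1_d z).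
      by apply/funext => z; rewrite indicI mulrC mulrA.
    rewrite bounded_integralM; first last.
    - exact: bounded_borel_indic.
    - by apply: (bounded_borel_on (c := n%:R)) => //; exact: mG.
    by rewrite bounded_integral_indic// Ef0 linear0.
  have mdC : borel (~` d) by exact: borelC.
  have -> : O j = E (~` d) (O j).
    have := spectralU hE (O j) md mdC (setICr _).
    by rewrite setUv (spectralT hE) Ed0 add0r.
  have bG : bounded_borel (fun z => G j z * \1_(~` d) z).
    by apply: (bounded_borel_on (c := 1)) => //; [exact: mG|move=> z; exact: Gle1].
  have eG : (fun z => \1_(~` d) z * G j z) = (fun z => G j z * \1_(~` d) z).
    by apply/funext => z; rewrite mulrC.
  rewrite -(bounded_integral_indic hE)// (hO _ Jj) ?eG//; last first.
    exact: bounded_borel_indic.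
  rewrite -[leRHS]mulr1 /r mulrAC; apply: hK => //.
  by apply: bounded_by_indicP => // z; exact: Gle1.
pose r := rnorm (E d f) / K.
have r0 : 0 < r by rewrite divr_gt0 ?rnorm_gt0.
have oO : open [set x : X | rnorm x < r].
  apply/open_rnormP => x /= rx; exists (r - rnorm x); first by rewrite subr_gt0.
  by move=> y hy; have := rnormB x (x - y); rewrite opprB addrCA subrr addr0; lra.
have [|y [/= hy [j Jj Oy]]] := hd _ _ oO.
  by exists 0; rewrite /= rnorm0.
move: hy; rewrite -Oy; apply/negP; rewrite -leNgt /r ler_pdivrMr// mulrC -[K]mulr1.
have G0 z : d z -> G j z != 0.
  move=> dz; apply/eqP => G0; have := Gge1 _ _ Jj dz.
  by rewrite G0 rnorm0 ler10.
have Vle1 z : d z -> rnorm (G j z)^-1 <= 1.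
  by move=> dz; rewrite rnormV invf_le1 ?Gge1// rnorm_gt0// G0.
have bH : bounded_borel (fun z => (G j z)^-1 * \1_d z).
  apply: (bounded_borel_on (c := 1)) => //.
  by apply: cmeasurableV; exact: mG.
have e : (fun z => (G j z)^-1 * \1_d z * G j z) = \1_d.
  apply/funext => z; rewrite mulrAC /indic.
  have [/set_mem/G0 Gz|_] := boolP (z \in d); last by rewrite mulr0.
  by rewrite mulr1 mulVf.
rewrite -(bounded_integral_indic hE)// -e -(hO _ Jj) ?e//; last first.
  exact: bounded_borel_indic.
by apply: hK => //; exact: bounded_by_indicP.
Unshelve. all: by end_near. Qed.

End FunctionalCalculus.

(** * The complex exponential *)

Section ComplexExponential.
Variable R : realType.
Implicit Types z w : R[i].

Lemma rnorm_cexp z : rnorm (cexp z) = expR (complex.Re z).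
Proof.
rewrite /cexp rnormM rnormC ger0_norm ?expR_ge0// rnorm_sqrt/=.
by rewrite cos2Dsin2 sqrtr1 mulr1.
Qed.

Lemma cexpD z w : cexp (z + w) = cexp z * cexp w.
Proof.
rewrite /cexp; case: z w => [a b] [c d] /=; rewrite expRD cosD sinD.
apply/eqP; rewrite eq_complex/=; apply/andP; split; apply/eqP; ring.
Qed.

Lemma cexp0 : cexp (0 : R[i]) = 1.
Proof.
rewrite /cexp/= expR0 cos0 sin0; apply/eqP.
by rewrite eq_complex/= !mul0r !mulr0 mulr1 subr0 addr0 !eqxx.
Qed.

End ComplexExponential.

(** * Powers, spectrum and exponentials of a scalar type operator *)

Section ScalarTypeOperator.
Variables (R : realType) (X : completeNormedModType R[i]).
Variables (A : linear_op X) (E : set R[i] -> {linear X -> X}).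
Hypothesis hA : scalar_type_spectral A E.
Implicit Types (d : set R[i]) (f g : X) (l z : R[i]).

Let hE : spectral_measure E := hA.1.

Lemma scalar_integrates f : dom A f -> integrates E (@id R[i]) f (A f).
Proof.
move=> Af; have [_ [dA eA]] := hA; rewrite (eA _ Af).
by apply: integrates_dom => //; [exact: cmeasurable_id|rewrite -dA].
Qed.

Lemma integrates_scalar f g : integrates E (@id R[i]) f g -> dom A f /\ A f = g.
Proof.
move=> /(integrates_eq hE (@cmeasurable_id R))[df ef].
have [_ [dA eA]] := hA; have Af : dom A f by rewrite dA.
by rewrite (eA _ Af).
Qed.

Lemma pow_integrates n f : dom (pow_op A n) f ->
  integrates E (fun z => z ^+ n) f (pow_op A n f).
Proof.
elim: n => [_|n IH [df dAf]] H bH bHG.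
  by congr (bounded_integral E _ f); apply/funext => z; rewrite expr0 mulr1.
have [mH [c hc]] := bH; have [_ [c' hc']] := bHG.
(* Peeling off one factor z needs H z bounded: by the bound of H where |z| <= 1, and by that of H
   z^(n+1) elsewhere. *)
have bHz : bounded_borel (fun z => H z * z).
  split; first by apply: cmeasurableM => //; exact: cmeasurable_id.
  exists (Num.max c c') => z; rewrite le_max.
  have [z1|z1] := leP (rnorm z) 1.
    rewrite rnormM; apply/orP; left; rewrite -[c]mulr1.
    by rewrite ler_pM ?rnorm_ge0.
  apply/orP; right; apply: le_trans (hc' z); rewrite !rnormM ler_wpM2l ?rnorm_ge0//.
  by rewrite rnormX exprS ler_peMr ?rnorm_ge0// exprn_ege1// ltW.
have e : (fun z => H z * z ^+ n.+1) = (fun z => (H z * z) * z ^+ n).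
  by apply/funext => z; rewrite exprS mulrA.
rewrite e in bHG *; rewrite (scalar_integrates dAf bH bHz).
exact: IH.
Qed.

Lemma scalar_type_not_hypercyclic : ~ hypercyclic A.
Proof.
move=> [f [f0 df]].
apply: (integrates_orbit_not_dense hE (J := setT) (G := fun n z => z ^+ n)
  (d := ~` [set z | rnorm z <= 1]) f0).
- by apply: borelC; apply: (borel_rnorm_le (F := id)); exact: cmeasurable_id.
- by move=> n _; apply: cmeasurableX; exact: cmeasurable_id.
- move=> n z _ /= /negP; rewrite -ltNge => z1; rewrite rnormX.
  by rewrite exprn_ege1// ltW.
- move=> n z _ /= /contrapT z1; rewrite rnormX.
  by rewrite exprn_ile1// rnorm_ge0.
- by move=> n _; apply: pow_integrates; exact: df.
Qed.

Definition disc l (r : R) : set R[i] := [set z | rnorm (z - l) < r].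

Lemma borel_disc l r : borel (disc l r).
Proof.
apply: borel_open; apply: open_complexP => z /= zr.
exists (r - rnorm (z - l)); first by rewrite subr_gt0.
move=> y hy; rewrite /disc/= -(subrK z y) -addrA (le_lt_trans (rnormD _ _))//.
by rewrite rdistC; move: hy; lra.
Qed.

(** On the range of E (disc l r), A - l is bounded above by K r, while a resolvent bounded by s
    bounds it below by 1 / s. For r = 1 / (2 s K) this gives |v| <= |v| / 2. *)
Lemma resolvent_disc_null l : resolvent_set A l ->
  exists2 r : R, 0 < r & forall f, E (disc l r) f = 0.
Proof.
move=> [S [Sc S1 S2]]; have [s s0 hs] := continuous_linear_rnorm Sc.
have [K K0 hK] := bounded_integral_le hE.
exists (2 * (s * K))^-1 => [|f]; first by rewrite invr_gt0 !mulr_gt0.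
set r := _^-1; have r0 : 0 < r by rewrite invr_gt0 !mulr_gt0.
set d := disc l r; have md : borel d by exact: borel_disc.
set v := E d f.
have bd : bounded_borel (fun z => z * \1_d z).
  apply: (bounded_borel_on (c := r + rnorm l)) => //; first exact: cmeasurable_id.
    by rewrite addr_ge0 ?rnorm_ge0// ltW.
  by move=> z dz; rewrite -(subrK l z) (le_trans (rnormD _ _))// lerD2r ltW.
have Ev : E d v = v by exact: (spectral_proj hE).
have [dv Av] : dom A v /\ A v = bounded_integral E (fun z => z * \1_d z) v.
  apply: integrates_scalar => H bH bHG.
  rewrite -[in RHS]Ev -[in RHS](bounded_integral_indic hE)//.
  rewrite -!(bounded_integralM hE)//; last exact: bounded_borel_indic.
  by congr (bounded_integral E _ v); apply/funext => z; rewrite mulrA.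
have e : A v - l *: v = bounded_integral E (fun z => (z - l) * \1_d z) v.
  rewrite Av -[in X in _ - X]Ev -[in X in _ - X](bounded_integral_indic hE)//.
  rewrite addrC -scaleNr -(bounded_integral_linear hE)//; last first.
    exact: bounded_borel_indic.
  by congr (bounded_integral E _ v); apply/funext => z; ring.
apply: rnorm_le0.
have h1 : rnorm (A v - l *: v) <= K * r * rnorm v.
  rewrite e; apply: hK => //; last first.
  - by apply: bounded_by_indicP => [|z]; exact: ltW.
  - exact: ltW.
  - apply: (bounded_borel_on (c := r)) => //; last by move=> z; exact: ltW.
      by apply: cmeasurableD; [exact: cmeasurable_id|exact: cmeasurable_cst].
    exact: ltW.
have h2 := hs (A v - l *: v); rewrite (S2 _ dv) in h2.
have h3 : s * (K * r * rnorm v) = rnorm v / 2.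
  by rewrite /r; field; rewrite !gt_eqF.
have : s * rnorm (A v - l *: v) <= s * (K * r * rnorm v) by rewrite ler_pM2l.
rewrite h3 -/v; lra.
Qed.

(** The resolvent is the integral of 1 / (z - l) off the disc, where this function is at most 1 / r;
    A composed with it integrates z / (z - l) = l / (z - l) + 1. *)
Lemma disc_null_resolvent l r : 0 < r -> (forall f, E (disc l r) f = 0) ->
  resolvent_set A l.
Proof.
move=> r0 null; set d := disc l r; have md : borel d by exact: borel_disc.
have mdC : borel (~` d) by exact: borelC.
have EdC f : E (~` d) f = f.
  have := spectralU hE f md mdC (setICr _).
  by rewrite setUv (spectralT hE) null add0r.
have mzl : cmeasurable (fun z : R[i] => z - l).
  by apply: cmeasurableD; [exact: cmeasurable_id|exact: cmeasurable_cst].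
pose V z : R[i] := (z - l)^-1 * \1_(~` d) z.
have zl z : (~` d) z -> z - l != 0.
  move=> dz; apply/eqP => zl0; apply: dz.
  by rewrite /d /disc/= zl0 rnorm0.
have bV : bounded_borel V.
  apply: (bounded_borel_on (c := r^-1)) => //; first exact: cmeasurableV.
    by rewrite invr_ge0 ltW.
  move=> z dz; rewrite rnormV lef_pV2 ?posrE ?rnorm_gt0 ?zl//.
  by rewrite leNgt; apply/negP.
have eV z : V z * (z - l) = \1_(~` d) z.
  rewrite /V /indic; have [/set_mem/zl dz|_] := boolP (z \in ~` d).
    by rewrite mulr1 mulVf.
  by rewrite mulr0 mul0r.
have bI := bounded_borel_indic mdC.
have eVz : (fun z => V z * z) = (fun z => l * V z + \1_(~` d) z).
  by apply/funext => z; rewrite -eV; ring.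
have bVz : bounded_borel (fun z => V z * z).
  rewrite eVz; split.
    apply: cmeasurableD; last by case: bI.
    by apply: cmeasurableM; [exact: cmeasurable_cst|case: bV].
  have [_ [c hc]] := bV; exists (rnorm l * c + 1) => z.
  rewrite (le_trans (rnormD _ _))// lerD ?rnorm_indic_le1// rnormM.
  by rewrite ler_wpM2l ?rnorm_ge0.
have IVz f : bounded_integral E (fun z => V z * z) f =
    l *: bounded_integral E V f + f.
  by rewrite eVz (bounded_integral_linear hE)// (bounded_integral_indic hE)// EdC.
exists (bounded_integral E V); split.
- exact: bounded_integral_continuous.
- move=> g; have [dg ->] : dom A (bounded_integral E V g) /\
      A (bounded_integral E V g) = bounded_integral E (fun z => V z * z) g.
    apply: integrates_scalar => H bH bHG.
    rewrite -!(bounded_integralM hE)//.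
    by congr (bounded_integral E _ g); apply/funext => z; ring.
  by split => //; rewrite IVz addrAC subrr add0r.
- move=> f df; rewrite linearB/= linearZ/=.
  by rewrite (scalar_integrates df bV bVz) IVz addrAC subrr add0r.
Qed.

(** Enumerates the null discs with rational centre and radius 1 / (k + 1); every other code gives
    the empty set. *)
Let null_disc (n : nat) : set R[i] :=
  if unpickle n is Some (p, q, k) then
    let c := ratr p +i* ratr q in
    if `[< forall f, E (disc c k.+1%:R^-1) f = 0 >] then disc c k.+1%:R^-1
    else set0
  else set0.

Let borel_null_disc n : borel (null_disc n).
Proof.
rewrite /null_disc; case: unpickle => [[[p q] k]|]; last exact: borel0.
by case: ifP => _; [exact: borel_disc|exact: borel0].
Qed.

Let spectral_null_disc n f : E (null_disc n) f = 0.
Proof.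
rewrite /null_disc; case: unpickle => [[[p q] k]|]; last exact: (spectral0 hE).
by case: ifPn => [/asboolP|_]; [exact|exact: (spectral0 hE)].
Qed.

Lemma resolvent_bigcup_null : resolvent_set A = \bigcup_n null_disc n.
Proof.
apply/seteqP; split => l.
  move=> /resolvent_disc_null[r r0 null].
  (* As 2 e < r, a disc of radius e around a rational point closer than e to l contains l and lies
     in the null disc. *)
  pose k := Num.truncn (2 / r); pose e : R := k.+1%:R^-1.
  have e0 : 0 < e by rewrite invr_gt0.
  have e2 : e + e < r.
    have : 2 / r < k.+1%:R by exact: truncnS_gt.
    rewrite ltr_pdivrMr// -(ltr_pM2l e0) mulrA mulVf// mul1r; lra.
  have rat (x : R) : exists q : rat, `|x - ratr q| < e / 2.
    have [|q] := @rat_in_itvoo R (x - e / 2) (x + e / 2); first by lra.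
    by rewrite in_itv/= => /andP[h1 h2]; exists q; rewrite ltr_norml; lra.
  have [p hp] := rat (complex.Re l); have [q hq] := rat (complex.Im l).
  have lc : rnorm (l - (ratr p +i* ratr q)) < e.
    rewrite (le_lt_trans (rnorm_le_ReIm _))//.
    by case: l hp hq {null} => a b /= hp hq; lra.
  exists (pickle (p, q, k)); first exact: Logic.I.
  rewrite /null_disc pickleK.
  rewrite -/e; case: ifPn => [//|/asboolP[]] f.
  apply: (spectral_sub0 hE (borel_disc _ _) (borel_disc l r)) => // z /= hz.
  rewrite /disc/= -(subrK (ratr p +i* ratr q) z) -addrA.
  rewrite (le_lt_trans (rnormD _ _))// (rdistC _ l).
  by move: hz lc; rewrite /disc/= -/e; lra.
move=> [n _]; rewrite /null_disc.
case: unpickle => [[[p q] k]|//]; case: ifPn => [/asboolP null /= hl|//].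
set c := _ +i* _ in null hl; set r := _^-1 in null hl.
apply: (@disc_null_resolvent l (r - rnorm (l - c))) => [|f].
  by rewrite subr_gt0.
apply: (spectral_sub0 hE (borel_disc _ _) (borel_disc c r)) => // z /= hz.
rewrite /disc/= -(subrK l z) -addrA (le_lt_trans (rnormD _ _))//.
by move: hz; rewrite /disc/=; lra.
Qed.

Lemma borel_spectrum : borel (spectrum A).
Proof.
by apply: borelC; rewrite resolvent_bigcup_null; exact: borel_bigcup.
Qed.

Lemma spectral_spectrum f : E (spectrum A) f = f.
Proof.
have mr : borel (resolvent_set A).
  by rewrite resolvent_bigcup_null; exact: borel_bigcup.
have := spectralU hE f mr borel_spectrum (setICr _).
rewrite setUv (spectralT hE) resolvent_bigcup_null.
by rewrite (spectral_bigcup0 hE)// add0r.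
Qed.

Definition exp_fun (t : R) (z : R[i]) : R[i] := cexp (t%:C * z) * \1_(spectrum A) z.

Lemma cmeasurable_exp_fun t : cmeasurable (exp_fun t).
Proof.
apply: cmeasurableM; last by apply: cmeasurable_indic; exact: borel_spectrum.
apply: cmeasurable_cexp; apply: cmeasurableM; last exact: cmeasurable_id.
exact: cmeasurable_cst.
Qed.

Lemma exp_not_hypercyclic :
  ~ hypercyclic_family [set t : R | 0 <= t] (exp_op A E).
Proof.
move=> [f [f0 df]].
have mRe := borel_Re_le (0 : R).
apply: (integrates_orbit_not_dense hE (G := exp_fun)
  (d := spectrum A `&` ~` [set z | complex.Re z <= 0]) f0).
- by apply: borelI; [exact: borel_spectrum|exact: borelC].
- by move=> t _; exact: cmeasurable_exp_fun.
- move=> t z /= t0 [sz /negP]; rewrite -ltNge => z0.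
  rewrite /exp_fun rnormM rnorm_indic rnorm_cexp Re_scale /indic mem_set// mulr1.
  by rewrite -expR0 ler_expR mulr_ge0// ltW.
(* Off the spectrum the integrand is 0, so only spectral points with Re z <= 0 have to be
   estimated. *)
- move=> t z /= t0 nz; rewrite /exp_fun rnormM rnorm_indic rnorm_cexp Re_scale.
  rewrite /indic; have [/set_mem sz|_] := boolP (z \in _); last by rewrite mulr0.
  have [z0|z0] := pselect (complex.Re z <= 0); last by case: nz.
  by rewrite mulr1 -expR0 ler_expR mulr_ge0_le0.
- move=> t t0; apply: integrates_dom => //; first exact: cmeasurable_exp_fun.
  exact: df.
Qed.

End ScalarTypeOperator.

(** * First- and second-order estimates for the exponential *)

Section ExponentialEstimates.
Variable R : realType.
Implicit Types (x b c : R) (z : R[i]).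

Lemma MVT_from0 (f df : R -> R) b : 0 <= b ->
  (forall x, is_derive x 1 f (df x)) ->
  exists2 c, 0 <= c <= b & f b - f 0 = df c * b.
Proof.
move=> b0 hf; have [|c] := @MVT_segment R f df 0 b b0 (fun x _ => hf x).
  apply: continuous_subspaceT => x; apply: differentiable_continuous.
  by apply/derivable1_diffP; apply: ex_derive.
by rewrite in_itv/= => hb hc; exists c => //; rewrite hc subr0.
Qed.

Lemma ler_norm_sin b : `|sin b| <= `|b|.
Proof.
wlog b0 : b / 0 <= b.
  move=> hw; have [/hw//|/ltW b0] := leP 0 b.
  by rewrite -(normrN b) -(normrN (sin b)) -sinN hw// oppr_ge0.
have [c _] := MVT_from0 b0 (@is_derive_sin R).
rewrite sin0 subr0 => ->; rewrite normrM -[leRHS]mul1r ler_wpM2r//.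
by rewrite ler_norml cos_geN1 cos_le1.
Qed.

Lemma ler_norm_cosB1 b : `|cos b - 1| <= b ^+ 2 /\ `|cos b - 1| <= `|b|.
Proof.
wlog b0 : b / 0 <= b.
  move=> hw; have [/hw//|/ltW b0] := leP 0 b.
  by have := hw (- b); rewrite oppr_ge0 cosN normrN sqrrN; exact.
have [c /andP[c0 cb]] := MVT_from0 b0 (@is_derive_cos R).
rewrite cos0 => ->; rewrite normrM normrN (ger0_norm b0); split.
  rewrite expr2 ler_wpM2r// (le_trans (ler_norm_sin c))//.
  by rewrite ger0_norm.
by rewrite -[leRHS]mul1r ler_wpM2r// ler_norml sin_geN1 sin_le1.
Qed.

Lemma ler_norm_sinB b : `|sin b - b| <= b ^+ 2.
Proof.
wlog b0 : b / 0 <= b.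
  move=> hw; have [/hw//|/ltW b0] := leP 0 b.
  by have := hw (- b); rewrite oppr_ge0 sinN -opprD normrN sqrrN; exact.
have [c /andP[c0 cb]] := MVT_from0 b0 (@is_derive_sin R).
rewrite sin0 subr0 => ->; rewrite -[X in _ * _ - X]mul1r -mulrBl normrM.
rewrite (ger0_norm b0) expr2 ler_wpM2r//.
have [_ h] := ler_norm_cosB1 c; rewrite (le_trans h)//.
by rewrite ger0_norm.
Qed.

Lemma expR_sub1_le x : expR x - 1 <= x * expR x.
Proof.
have := expR_ge1Dx (- x); rewrite -(ler_pM2r (expR_gt0 x)).
by rewrite -expRD addNr expR0; lra.
Qed.

Lemma ler_norm_expRB1 x c : 0 <= c -> x <= c -> `|expR x - 1| <= `|x| * expR c.
Proof.
move=> c0 xc; rewrite ler_norml; apply/andP; split.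
  have h1 := expR_ge1Dx x.
  have h2 : 1 <= expR c by rewrite -expR0 ler_expR.
  have h3 : `|x| * 1 <= `|x| * expR c by rewrite ler_wpM2l.
  by have := ler_norm (- x); rewrite normrN; lra.
apply: le_trans (expR_sub1_le x) _.
apply: (@le_trans _ _ (`|x| * expR x)).
  by rewrite ler_wpM2r ?expR_ge0// ler_norm.
by rewrite ler_wpM2l// ler_expR.
Qed.

Lemma ler_norm_expRB1B x c : 0 <= c -> x <= c ->
  `|expR x - 1 - x| <= `|x| ^+ 2 * expR c.
Proof.
move=> c0 xc; rewrite ger0_norm; last by have := expR_ge1Dx x; lra.
apply: (@le_trans _ _ (x * (expR x - 1))).
  by have := expR_sub1_le x; lra.
rewrite (le_trans (ler_norm _))// normrM expr2 -mulrA ler_wpM2l//.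
exact: ler_norm_expRB1.
Qed.

Lemma Re_cexp z : complex.Re (cexp z) = expR (complex.Re z) * cos (complex.Im z).
Proof. by rewrite /cexp/= mul0r subr0. Qed.

Lemma Im_cexp z : complex.Im (cexp z) = expR (complex.Re z) * sin (complex.Im z).
Proof. by rewrite /cexp/= mul0r addr0. Qed.

(** Only Re z is bounded, as the spectrum may be unbounded inside its half-plane. The 3 counts e^a
    (cos b - 1), e^a - 1 and e^a sin b, for z = a + i b. *)
Lemma rnorm_cexpB1 z c : 0 <= c -> complex.Re z <= c ->
  rnorm (cexp z - 1) <= 3 * rnorm z * expR c.
Proof.
move=> c0 zc; rewrite (le_trans (rnorm_le_ReIm _))//.
have hRe := Re_le_rnorm z; have hIm := Im_le_rnorm z.
have h1 := ler_norm_expRB1 c0 zc; have [_ h2] := ler_norm_cosB1 (complex.Im z).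
have h3 := ler_norm_sin (complex.Im z).
have ec : expR (complex.Re z) <= expR c by rewrite ler_expR.
have e0 := expR_gt0 (complex.Re z).
have -> : complex.Re (cexp z - 1) = expR (complex.Re z) * (cos (complex.Im z) - 1)
    + (expR (complex.Re z) - 1).
  by rewrite -[complex.Re (_ - _)]/(complex.Re (cexp z) - 1) Re_cexp; ring.
have -> : complex.Im (cexp z - 1) = expR (complex.Re z) * sin (complex.Im z).
  by rewrite -[complex.Im (_ - _)]/(complex.Im (cexp z) - 0) Im_cexp subr0.
move: hRe hIm h1 h2 h3 ec e0.
set a := complex.Re z; set b := complex.Im z; set r := rnorm z.
move=> hRe hIm h1 h2 h3 ec e0.
have k1 : `|expR a * (cos b - 1)| <= expR c * r.
  rewrite normrM (ger0_norm (ltW e0)) ler_pM ?(ltW e0)//; exact: le_trans h2 hIm.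
have k2 : `|expR a * sin b| <= expR c * r.
  rewrite normrM (ger0_norm (ltW e0)) ler_pM ?(ltW e0)//; exact: le_trans h3 hIm.
have k3 : `|a| * expR c <= r * expR c by rewrite ler_wpM2r// expR_ge0.
by have := ler_normD (expR a * (cos b - 1)) (expR a - 1); lra.
Qed.

(** The 4 counts the quadratic terms e^a (cos b - 1), e^a - 1 - a, (e^a - 1) sin b and sin b - b,
    for z = a + i b. *)
Lemma rnorm_cexpB1B z c : rnorm z <= c ->
  rnorm (cexp z - 1 - z) <= 4 * rnorm z ^+ 2 * expR c.
Proof.
move=> zc; rewrite (le_trans (rnorm_le_ReIm _))//.
have hRe := Re_le_rnorm z; have hIm := Im_le_rnorm z.
have c0 : 0 <= c := le_trans (rnorm_ge0 z) zc.
have ac : complex.Re z <= c by rewrite (le_trans (ler_norm _))// (le_trans hRe).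
have h0 := ler_norm_expRB1 c0 ac.
have h1 := ler_norm_expRB1B c0 ac; have [h2 _] := ler_norm_cosB1 (complex.Im z).
have h3 := ler_norm_sin (complex.Im z); have h4 := ler_norm_sinB (complex.Im z).
have ec : expR (complex.Re z) <= expR c by rewrite ler_expR.
have e1 : 1 <= expR c by rewrite -expR0 ler_expR.
have e0 := expR_gt0 (complex.Re z).
have -> : complex.Re (cexp z - 1 - z) =
    expR (complex.Re z) * (cos (complex.Im z) - 1)
    + (expR (complex.Re z) - 1 - complex.Re z).
  rewrite (_ : complex.Re (_ - _) = complex.Re (cexp z) - 1 - complex.Re z).
    by rewrite Re_cexp; ring.
  by case: (cexp z) => ? ?; case: z {zc hRe hIm ac h0 h1 h2 h3 h4 ec e0}.
have -> : complex.Im (cexp z - 1 - z) =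
    (expR (complex.Re z) - 1) * sin (complex.Im z)
    + (sin (complex.Im z) - complex.Im z).
  rewrite (_ : complex.Im (_ - _) = complex.Im (cexp z) - 0 - complex.Im z).
    by rewrite Im_cexp; ring.
  by case: (cexp z) => ? ?; case: z {zc hRe hIm ac h0 h1 h2 h3 h4 ec e0}.
move: hRe hIm h0 h1 h2 h3 h4 ec e0.
set a := complex.Re z; set b := complex.Im z; set r := rnorm z.
move=> hRe hIm h0 h1 h2 h3 h4 ec e0.
have r0 : 0 <= r by exact: rnorm_ge0.
have b2 : b ^+ 2 <= r ^+ 2 by rewrite -(real_normK (num_real b)) ler_pXn2r// nnegrE.
have a2 : `|a| ^+ 2 <= r ^+ 2 by rewrite ler_pXn2r// nnegrE.
have k1 : `|expR a * (cos b - 1)| <= expR c * r ^+ 2.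
  rewrite normrM (ger0_norm (ltW e0)) ler_pM ?(ltW e0)//; exact: le_trans h2 b2.
have k2 : `|(expR a - 1) * sin b| <= (r * expR c) * r.
  rewrite normrM ler_pM//; last exact: le_trans h3 hIm.
  by rewrite (le_trans h0)// ler_wpM2r// expR_ge0.
have k3 : `|a| ^+ 2 * expR c <= r ^+ 2 * expR c by rewrite ler_wpM2r// expR_ge0.
have k4 : r ^+ 2 * 1 <= r ^+ 2 * expR c by rewrite ler_wpM2l// exprn_ge0.
have k5 : (r * expR c) * r = r ^+ 2 * expR c by rewrite expr2; ring.
have := ler_normD (expR a * (cos b - 1)) (expR a - 1 - a).
by have := ler_normD ((expR a - 1) * sin b) (sin b - b); lra.
Qed.

End ExponentialEstimates.

(** * The exponentials as a strongly continuous semigroup *)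

Section Semigroup.
Variables (R : realType) (X : completeNormedModType R[i]).
Variables (A : linear_op X) (E : set R[i] -> {linear X -> X}).
Hypothesis hA : scalar_type_spectral A E.
Variable w : R.
Hypothesis hw : spectrum A `<=` [set l | complex.Re l <= w].
Implicit Types (f g : X) (z : R[i]) (t h : R).

Let hE : spectral_measure E := hA.1.
Let sA := spectrum A.
Let bs : borel sA := borel_spectrum hA.

Lemma bounded_integral_spectrum F f : bounded_borel F ->
  bounded_integral E (fun z => F z * \1_sA z) f = bounded_integral E F f.
Proof.
move=> bF; rewrite (bounded_integralM hE)//; last exact: bounded_borel_indic.
by rewrite (bounded_integral_indic hE)// (spectral_spectrum hA).
Qed.

Lemma Re_scale_le t z : 0 <= t -> sA z -> complex.Re (t%:C * z) <= t * `|w|.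
Proof.
move=> t0 /hw /= zw; rewrite Re_scale ler_wpM2l// (le_trans zw)//.
exact: ler_norm.
Qed.

Lemma exp_fun_bounded_by t : 0 <= t ->
  bounded_by (exp_fun A t) (expR (t * `|w|)).
Proof.
move=> t0; apply: bounded_by_indicP => [|z sz]; first exact: expR_ge0.
by rewrite rnorm_cexp ler_expR Re_scale_le.
Qed.

Lemma bounded_borel_exp_fun t : 0 <= t -> bounded_borel (exp_fun A t).
Proof.
move=> t0; split; first exact: (cmeasurable_exp_fun hA).
by exists (expR (t * `|w|)); exact: exp_fun_bounded_by.
Qed.

(** A dominated convergence argument: the part of f outside a large disc is small and [B] controls
    it for all h, while inside the disc the error is at most C h. *)
Lemma bounded_integral_cvg_id (Phi : R -> R[i] -> R[i]) (B : R) f :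
  (forall h, 0 < h <= 1 -> bounded_borel (Phi h)) ->
  (forall h, 0 < h <= 1 -> bounded_by (Phi h) B) ->
  (forall n : nat, exists C : R, forall h z, 0 < h <= 1 -> rnorm z <= n%:R ->
    rnorm (Phi h z - \1_sA z) <= C * h) ->
  bounded_integral E (Phi h) f @[h --> 0^'+] --> f.
Proof.
move=> bP PB Pn; have [K K0 hK] := bounded_integral_le hE.
have bI := bounded_borel_indic bs.
have B0 : 0 <= B.
  by apply: le_trans (rnorm_ge0 _) (PB 1 _ 0); rewrite ltr01 lexx.
apply/cvg_rnormP => e e0.
have Kb : 0 < K * (B + 1) by rewrite mulr_gt0// ltr_wpDl.
have e1 : 0 < e / 2 / (K * (B + 1)) by rewrite !divr_gt0.
have /cvg_rnormP/(_ _ e1) := @spectral_rnorm_le_cvg _ _ _ hE id f (@cmeasurable_id R).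
move=> [n _ /(_ n (leqnn n))]; set d := [set z | _] => /= hn.
have md : borel d by apply: (borel_rnorm_le (F := id)); exact: cmeasurable_id.
have [C hC] := Pn n.
have C1 : 0 < K * (`|C| + 1) * (rnorm f + 1).
  by rewrite !mulr_gt0// ltr_wpDl ?rnorm_ge0.
pose del : R := e / 2 / (K * (`|C| + 1) * (rnorm f + 1)).
have del0 : 0 < del by rewrite !divr_gt0.
near=> h.
have h0 : 0 < h by near: h; exact: nbhs_right_gt.
have h1 : h <= 1 by near: h; exact: nbhs_right_le.
have hd : h <= del by near: h; exact: nbhs_right_le.
have h01 : 0 < h <= 1 by rewrite h0 h1.
have bPh := bP _ h01; have bD := bounded_borelB bPh bI.
have -> : bounded_integral E (Phi h) f - f =
    bounded_integral E (fun z => Phi h z - \1_sA z) f.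
  by rewrite (bounded_integralB hE)// (bounded_integral_indic hE)// (spectral_spectrum hA).
set D := fun z => Phi h z - \1_sA z in bD *.
have -> : bounded_integral E D f =
    bounded_integral E (fun z => D z * \1_d z) f -
    bounded_integral E D (E d f - f).
  rewrite (bounded_integralM hE)//; last exact: bounded_borel_indic.
  by rewrite (bounded_integral_indic hE)// -linearB/= opprB addrC subrK.
have Dd z : d z -> rnorm (D z) <= (`|C| + 1) * h.
  move=> dz; rewrite (le_trans (hC _ _ h01 dz))// ler_wpM2r ?(ltW h0)//.
  by rewrite (le_trans (ler_norm _))// lerDl.
have Ch : 0 <= (`|C| + 1) * h by rewrite mulr_ge0 ?addr_ge0// ltW.
have DB : bounded_by D (B + 1).
  by move=> z; rewrite (le_trans (rnormB _ _))// lerD ?PB// rnorm_indic_le1.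
rewrite (le_trans (rnormB _ _))// (splitr e) lerD//.
  apply: (le_trans (hK _ _ f _ Ch (bounded_by_indicP Ch Dd))).
    by apply: bounded_borelM => //; exact: bounded_borel_indic.
  apply: (@le_trans _ _ (K * ((`|C| + 1) * del) * rnorm f)).
    by rewrite ler_wpM2r ?rnorm_ge0// ler_pM2l// ler_wpM2l.
  have -> : e / 2 = K * ((`|C| + 1) * del) * (rnorm f + 1).
    have := divfK (lt0r_neq0 C1) (e / 2); rewrite -/del => <-; ring.
  rewrite ler_wpM2l// ?lerDl// mulr_ge0 ?(ltW K0)// mulr_ge0 ?addr_ge0//.
  exact: ltW.
apply: (le_trans (hK _ (B + 1) _ bD (addr_ge0 B0 ler01) DB)).
by rewrite mulrC -ler_pdivlMr.
Unshelve. all: by end_near. Qed.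

Definition exp_semigroup t : {linear X -> X} := bounded_integral E (exp_fun A t).

Lemma exp_semigroup_C0 : C0_semigroup exp_semigroup.
Proof.
split.
- move=> t t0; apply: bounded_integral_continuous => //.
  exact: bounded_borel_exp_fun.
- move=> f; rewrite /exp_semigroup (_ : exp_fun A 0 = \1_sA).
    by rewrite (bounded_integral_indic hE)// (spectral_spectrum hA).
  by apply/funext => z; rewrite /exp_fun mul0r cexp0 mul1r.
- move=> s t f s0 t0; rewrite /exp_semigroup -(bounded_integralM hE)//;
    try exact: bounded_borel_exp_fun.
  congr (bounded_integral E _ f); apply/funext => z.
  (* Doubling the spectrum under the indicator gives each of the two factors its own copy. *)
  have -> : exp_fun A (s + t) z =
      cexp (s%:C * z) * cexp (t%:C * z) * \1_(spectrum A `&` spectrum A) z.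
    by rewrite setIid /exp_fun -cexpD -mulrDl -rmorphD.
  by rewrite indicI mulrACA.
- move=> f; apply: (bounded_integral_cvg_id (B := expR `|w|)).
  + by move=> h /andP[h0 _]; apply: bounded_borel_exp_fun; exact: ltW.
  + move=> h /andP[h0 h1] z; apply: le_trans (exp_fun_bounded_by (ltW h0) z) _.
    by rewrite ler_expR ler_piMl.
  + move=> n; exists (3 * n%:R * expR n%:R) => h z /andP[h0 h1] zn.
    rewrite /exp_fun -[X in _ - X]mul1r -mulrBl.
    rewrite rnormM (le_trans (ler_piMr (rnorm_ge0 _) (rnorm_indic_le1 _ _)))//.
    have hz : h * rnorm z <= n%:R.
      by rewrite (le_trans _ zn)// ler_piMl ?rnorm_ge0.
    have := @rnorm_cexpB1 _ (h%:C * z) n%:R (ler0n _ _).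
    rewrite scaleC_rnorm ?(ltW h0)// => H; apply: le_trans (H _) _.
      rewrite (le_trans (ler_norm _))// (le_trans (Re_le_rnorm _))//.
      by rewrite scaleC_rnorm// ltW.
    rewrite [leRHS](_ : _ = 3 * (h * n%:R) * expR n%:R); last by ring.
    by rewrite ler_wpM2r ?expR_ge0// !ler_wpM2l// ltW.
Qed.

End Semigroup.

(** * Identification of the generator with [A] *)

Section Generator.
Variables (R : realType) (X : completeNormedModType R[i]).
Variables (A : linear_op X) (E : set R[i] -> {linear X -> X}).
Hypothesis hA : scalar_type_spectral A E.
Variable w : R.
Hypothesis hw : spectrum A `<=` [set l | complex.Re l <= w].
Implicit Types (f g : X) (z : R[i]) (t h : R).

Let hE : spectral_measure E := hA.1.
Let sA := spectrum A.
Let bs : borel sA := borel_spectrum hA.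

Local Notation T := (exp_semigroup A E).

Definition exp_quotient h z : R[i] := (h^-1)%:C * (exp_fun A h z - \1_sA z).

(* The case split is needed because z / 0 = 0. *)
Definition exp_slope h z : R[i] :=
  if z == 0 then \1_sA z else exp_quotient h z / z.

Lemma bounded_borel_exp_quotient h : 0 < h -> bounded_borel (exp_quotient h).
Proof.
move=> h0; apply: bounded_borelM.
  by split; [exact: cmeasurable_cst|exists (rnorm (h^-1)%:C : R)].
apply: bounded_borelB; last exact: bounded_borel_indic.
by apply: (bounded_borel_exp_fun hA hw); exact: ltW.
Qed.

Lemma exp_quotient_integral h f : 0 < h ->
  bounded_integral E (exp_quotient h) f = diff_quotient T f h.
Proof.
move=> h0; rewrite /diff_quotient /exp_semigroup.
have be := bounded_borel_exp_fun hA hw (ltW h0).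
have bI := bounded_borel_indic bs.
rewrite -[X in _ *: (_ - X)](spectral_spectrum hA).
rewrite -[X in _ *: (_ - X)](bounded_integral_indic hE)// -(bounded_integralB hE)//.
have b0 : bounded_borel (fun=> 0 : R[i]).
  by split; [exact: cmeasurable_cst|exists 0 => z; rewrite rnorm0].
have := bounded_integral_linear hE (h^-1)%:C f (bounded_borelB be bI) b0.
have -> : bounded_integral E (fun=> 0) f = 0.
  rewrite -[RHS](subrr (bounded_integral E (fun=> 0) f)).
  rewrite -(bounded_integralB hE)//.
  by congr (bounded_integral E _ f); apply/funext => z; rewrite subrr.
rewrite addr0 => <-.
by congr (bounded_integral E _ f); apply/funext => z; rewrite addr0.
Qed.

Lemma exp_slopeM h z : exp_slope h z * z = exp_quotient h z.
Proof.
rewrite /exp_slope; have [->|z0] := eqVneq z 0; last by rewrite divfK.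
by rewrite /exp_quotient /exp_fun !mulr0 cexp0 mul1r subrr mulr0.
Qed.

Lemma exp_slope_off h z : z != 0 -> ~ sA z -> exp_slope h z = 0.
Proof.
move=> z0 sz; rewrite /exp_slope (negPf z0) /exp_quotient /exp_fun /indic.
by rewrite memNset// mulr0 subrr mulr0 mul0r.
Qed.

Lemma exp_slope_on h z : z != 0 -> sA z ->
  exp_slope h z = (cexp (h%:C * z) - 1) / (h%:C * z).
Proof.
move=> z0 sz; rewrite /exp_slope (negPf z0) /exp_quotient /exp_fun /indic.
by rewrite mem_set// !mulr1 invfM fmorphV/= mulrA [_^-1 * _]mulrC.
Qed.

Lemma exp_slope_bounded_by h : 0 < h <= 1 ->
  bounded_by (exp_slope h) (3 * expR `|w|).
Proof.
move=> /andP[h0 h1] z.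
have e1 : 1 <= expR `|w| by rewrite -expR0 ler_expR.
have [z0|z0] := eqVneq z 0.
  rewrite /exp_slope z0 eqxx (le_trans (rnorm_indic_le1 _ _))//; lra.
have [sz|sz] := pselect (sA z); last first.
  by rewrite exp_slope_off// rnorm0; lra.
have hz0 : 0 < h * rnorm z by rewrite mulr_gt0// rnorm_gt0.
rewrite exp_slope_on// rnormM rnormV scaleC_rnorm ?(ltW h0)//.
rewrite ler_pdivrMr// mulrAC -scaleC_rnorm ?(ltW h0)//.
apply: rnorm_cexpB1 => //; apply: le_trans (Re_scale_le hw (ltW h0) sz) _.
by rewrite ler_piMl.
Qed.

Lemma bounded_borel_exp_slope h : 0 < h <= 1 -> bounded_borel (exp_slope h).
Proof.
move=> h01; split; last by exists (3 * expR `|w|); exact: exp_slope_bounded_by.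
have b0 : borel [set z : R[i] | rnorm z <= 0].
  by apply: (borel_rnorm_le (F := id)); exact: cmeasurable_id.
(* The case split becomes a sum: the first term vanishes at 0 because 0^-1 = 0, and {|z| <= 0}
   singles out the origin. *)
rewrite (_ : exp_slope h = (fun z => exp_quotient h z * z^-1 +
    \1_[set z : R[i] | rnorm z <= 0] z * \1_sA z)).
  apply: cmeasurableD; apply: cmeasurableM.
  - by case/andP: h01 => h0 _; have [] := bounded_borel_exp_quotient h0.
  - by apply: cmeasurableV; exact: cmeasurable_id.
  - exact: cmeasurable_indic.
  - exact: cmeasurable_indic.
apply/funext => z; rewrite /exp_slope [in RHS]/indic.
have [->|z0] := eqVneq z 0.
  by rewrite mem_set/= ?rnorm0// invr0 mulr0 add0r mul1r.
rewrite memNset/=; first by rewrite mul0r addr0.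
by move/rnorm_le0/eqP; apply/negP.
Qed.

Lemma exp_slope_near1 (n : nat) : exists C : R, forall h z, 0 < h <= 1 ->
  rnorm z <= n%:R -> rnorm (exp_slope h z - \1_sA z) <= C * h.
Proof.
exists (4 * n%:R * expR n%:R) => h z /andP[h0 h1] zn.
have Ch : 0 <= 4 * n%:R * expR n%:R * h :> R.
  by rewrite !mulr_ge0// ?expR_ge0// ltW.
have [z0|z0] := eqVneq z 0.
  by rewrite /exp_slope z0 eqxx subrr rnorm0.
have [sz|sz] := pselect (sA z); last first.
  by rewrite exp_slope_off// /indic memNset// subrr rnorm0.
have hC0 : h%:C * z != 0.
  by rewrite mulf_neq0// (inj_eq (@complexI R)) gt_eqF.
have hz0 : 0 < h * rnorm z by rewrite mulr_gt0// rnorm_gt0.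
have -> : exp_slope h z - \1_sA z =
    (cexp (h%:C * z) - 1 - h%:C * z) / (h%:C * z).
  by rewrite exp_slope_on// /indic mem_set// [RHS]mulrBl mulfV.
rewrite rnormM rnormV scaleC_rnorm ?(ltW h0)// ler_pdivrMr//.
have hzn : h * rnorm z <= n%:R by rewrite (le_trans _ zn)// ler_piMl ?rnorm_ge0.
have := @rnorm_cexpB1B _ (h%:C * z) n%:R; rewrite scaleC_rnorm ?(ltW h0)//.
move=> /(_ hzn) H; apply: le_trans H _.
rewrite [leLHS](_ : _ = (4 * expR n%:R * h * rnorm z) * (h * rnorm z)); last by ring.
rewrite ler_wpM2r ?(ltW hz0)//.
rewrite [leRHS](_ : _ = (4 * expR n%:R * h) * n%:R); last by ring.
by rewrite ler_wpM2l// !mulr_ge0 ?expR_ge0// ltW.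
Qed.

Lemma exp_slope_cvg f :
  bounded_integral E (exp_slope h) f @[h --> 0^'+] --> f.
Proof.
apply: (bounded_integral_cvg_id hA (B := 3 * expR `|w|)).
- by move=> h h01; exact: bounded_borel_exp_slope.
- by move=> h h01; exact: exp_slope_bounded_by.
- exact: exp_slope_near1.
Qed.

(** The difference quotient of f is the slope operator applied to A f, and slope operators tend
    strongly to I. *)
Lemma diff_quotient_exp_cvg f : dom A f ->
  diff_quotient T f @ 0^'+ --> A f.
Proof.
move=> df; apply: cvg_trans (@exp_slope_cvg (A f)); apply: near_eq_cvg.
near=> h; have h0 : 0 < h by near: h; exact: nbhs_right_gt.
have h1 : h <= 1 by near: h; exact: nbhs_right_le.
have e : (fun z => exp_slope h z * z) = exp_quotient h.
  by apply/funext => z; exact: exp_slopeM.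
rewrite (scalar_integrates hA df) ?e ?exp_quotient_integral//.
- by apply: bounded_borel_exp_slope; rewrite h0 h1.
- exact: bounded_borel_exp_quotient.
Unshelve. all: by end_near. Qed.

(** For a test function H, H(A) of the difference quotient is the slope operator applied to (H z)(A)
    f; the limit is the test identity for A f = g. *)
Lemma diff_quotient_exp_dom f g : diff_quotient T f @ 0^'+ --> g ->
  dom A f /\ A f = g.
Proof.
move=> fg; apply: (integrates_scalar hA) => H bH bHz.
have h1 : bounded_integral E H (diff_quotient T f h) @[h --> 0^'+] -->
    bounded_integral E H g.
  by apply: (cvg_comp _ _ fg); exact: (bounded_integral_continuous hE).
apply: (cvg_unique _ h1); first exact: norm_hausdorff.
apply: cvg_trans (@exp_slope_cvg _); apply: near_eq_cvg.
near=> h; have h0 : 0 < h by near: h; exact: nbhs_right_gt.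
have hle1 : h <= 1 by near: h; exact: nbhs_right_le.
have h01 : 0 < h <= 1 by rewrite h0 hle1.
have bq := bounded_borel_exp_quotient h0; have bs' := bounded_borel_exp_slope h01.
rewrite -exp_quotient_integral// -!(bounded_integralM hE)//.
congr (bounded_integral E _ f); apply/funext => z.
by rewrite -exp_slopeM; ring.
Unshelve. all: by end_near. Qed.

Lemma exp_semigroup_generates : generates T A.
Proof.
split; first exact: (exp_semigroup_C0 hA hw).
split=> [|f /= cf].
  apply/seteqP; split => f /=; last by move=> /diff_quotient_exp_cvg/cvgP.
  by move=> cf; have [] := diff_quotient_exp_dom cf.
by have [_ ->] := diff_quotient_exp_dom cf.
Qed.

Lemma exp_op_semigroup t : 0 <= t -> op_eq (exp_op A E t) (total_op (T t)).
Proof.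
move=> t0; have h f := integrates_eq hE (cmeasurable_exp_fun hA t)
  (@bounded_integrates _ _ _ hE _ f (bounded_borel_exp_fun hA hw t0)).
split=> [|f _]; last by have [] := h f.
by apply/seteqP; split => // f _; have [] := h f.
Qed.

End Generator.

(** * Local bounds for C0-semigroups and invariance of the generator domain *)

Section C0Bounds.
Variables (R : realType) (X : completeNormedModType R[i]).
Variable T : R -> {linear X -> X}.
Hypothesis hT : C0_semigroup T.
Implicit Types (f : X) (s t : R).

Lemma near_right0P (P : R -> Prop) : (\forall t \near 0^'+, P t) ->
  exists2 d : R, 0 < d & forall t, 0 < t < d -> P t.
Proof.
move=> /nbhs_ballP[d /= d0 hd]; exists d => // t /andP[t0 td].
by apply: hd => //; rewrite -ball_normE/= sub0r normrN gtr0_norm.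
Qed.

(** Otherwise some times tending to 0 carry operators of unbounded norm, although strong continuity
    bounds them at each vector. *)
Lemma C0_bounded_near0 : exists d M : R, [/\ 0 < d, 1 <= M &
  forall s f, 0 <= s <= d -> rnorm (T s f) <= M * rnorm f].
Proof.
apply: contrapT => H.
have /choice[p hp] (n : nat) : exists p : R * X,
    0 <= p.1 <= n.+1%:R^-1 /\ n.+1%:R * rnorm p.2 < rnorm (T p.1 p.2).
  apply: contrapT => h; apply: H; exists n.+1%:R^-1, n.+1%:R; split.
  - by rewrite invr_gt0.
  - by rewrite ler1n.
  - move=> s f hs; rewrite leNgt; apply/negP => hf.
    by apply: h; exists (s, f).
have [|f|M hM] := @uniform_boundedness _ _ _ (fun n => T (p n).1).
- by move=> n; apply: (C0_bounded hT); have [/andP[]] := hp n.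
- have /cvg_rnormP/(_ _ ltr01)/near_right0P[d d0 hd] := C0_continuous hT (f := f).
  (* From index N + 1 on the times are below d; the finitely many earlier ones are absorbed by the
     sum. *)
  pose N := Num.truncn d^-1.
  exists (rnorm f + 1 + \sum_(i < N.+1) rnorm (T (p i).1 f)) => n.
  have S0 (P : pred 'I_N.+1) : 0 <= \sum_(i < N.+1 | P i) rnorm (T (p i).1 f).
    by apply: sumr_ge0 => i _; exact: rnorm_ge0.
  have [nN|Nn] := ltnP n N.+1.
    rewrite (bigD1 (Ordinal nN))//= addrCA lerDl addr_ge0 ?addr_ge0 ?rnorm_ge0//.
  apply: (@le_trans _ _ (rnorm f + 1)); last by rewrite lerDl.
  have [/andP[p0 pn] _] := hp n; move: p0; rewrite le_eqVlt => /orP[/eqP <-|p0].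
    by rewrite (C0_zero hT) lerDl.
  rewrite -[X in rnorm X](subrK f) (le_trans (rnormD _ _))// addrC lerD2l.
  apply: hd; rewrite p0/= (le_lt_trans pn)// invf_plt ?posrE//.
  by apply: (lt_le_trans (truncnS_gt _)); rewrite ler_nat ltnW.
- pose n := Num.truncn M; have [_] := hp n; rewrite ltNge => /negP; apply.
  rewrite (le_trans (hM n _))// ler_wpM2r ?rnorm_ge0// ltW//.
  exact: truncnS_gt.
Qed.

(** Each step of length d costs a factor M, and M >= 1 keeps the bound valid for shorter times. *)
Lemma C0_locally_bounded t : exists2 M : R, 0 < M &
  forall s f, 0 <= s <= t -> rnorm (T s f) <= M * rnorm f.
Proof.
have [d [M [d0 M1 hM]]] := C0_bounded_near0.
have M0 : 0 < M by exact: lt_le_trans M1.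
have hk k s f : 0 <= s <= k%:R * d -> rnorm (T s f) <= M ^+ k * rnorm f.
  elim: k s f => [|k IH] s f.
    rewrite mul0r => /le_anti <-; rewrite (C0_zero hT) expr0 mul1r//.
  move=> /andP[s0 sk]; have [sd|/ltW ds] := leP s d.
    rewrite (le_trans (hM _ _ _))// ?s0// ler_wpM2r ?rnorm_ge0//.
    by rewrite exprS ler_peMr ?(ltW M0)// exprn_ege1.
  rewrite -[s](subrK d) addrC (C0_add hT) ?(ltW d0) ?subr_ge0//.
  rewrite (le_trans (hM _ _ _)) ?(ltW d0) ?lexx// exprS -mulrA ler_pM2l//.
  apply: IH; rewrite subr_ge0 ds/=; move: sk; rewrite -natr1; lra.
exists (M ^+ (Num.truncn (t / d)).+1) => [|s f /andP[s0 st]].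
  by rewrite exprn_gt0.
apply: hk; rewrite s0 (le_trans st)//= -ler_pdivrMr// ltW//.
exact: truncnS_gt.
Qed.

Variable A : linear_op X.
Hypothesis gA : op_eq (generator T) A.

Lemma generator_cvg f : dom A f -> diff_quotient T f @ 0^'+ --> A f.
Proof. by have [dA eA] := gA; rewrite -dA => df; rewrite -eA. Qed.

(** By the semigroup law T s commutes with difference quotients, and it is continuous. *)
Lemma generator_invariant s f : 0 <= s -> dom A f ->
  dom A (T s f) /\ A (T s f) = T s (A f).
Proof.
move=> s0 df; have h : diff_quotient T (T s f) @ 0^'+ --> T s (A f).
  have h1 : T s (diff_quotient T f h) @[h --> 0^'+] --> T s (A f).
    by apply: (cvg_comp _ _ (generator_cvg df)); exact: (C0_bounded hT).
  apply: cvg_trans h1; apply: near_eq_cvg; near=> h.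
  have h0 : 0 <= h by apply: ltW; near: h; exact: nbhs_right_gt.
  by rewrite /diff_quotient linearZ/= linearB/= -!(C0_add hT)// (addrC s).
have [dA eA] := gA; have dTf : dom (generator T) (T s f) by exact: cvgP h.
rewrite -dA; split => //; rewrite -eA//.
by apply: cvg_lim h; exact: norm_hausdorff.
Unshelve. all: by end_near. Qed.

End C0Bounds.

(** * Uniqueness of the semigroup generated by [A] *)

Section Uniqueness.
Variables (R : realType) (X : completeNormedModType R[i]).
Variables (A : linear_op X) (E : set R[i] -> {linear X -> X}).
Hypothesis hA : scalar_type_spectral A E.
Variable w : R.
Hypothesis hw : spectrum A `<=` [set l | complex.Re l <= w].
Implicit Types (f g : X) (z : R[i]) (t h : R).

Let hE : spectral_measure E := hA.1.
Let sA := spectrum A.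
Let bs : borel sA := borel_spectrum hA.

Local Notation T := (exp_semigroup A E).

Variable T' : R -> {linear X -> X}.
Hypothesis gT' : generates T' A.

Let hT : C0_semigroup T := exp_semigroup_C0 hA hw.
Let hT' : C0_semigroup T' := gT'.1.

Let band (n : nat) : set R[i] := [set z | rnorm z <= n%:R].

Let borel_band n : borel (band n).
Proof. by apply: (borel_rnorm_le (F := id)); exact: cmeasurable_id. Qed.

Let bounded_borel_band_id n : bounded_borel (fun z => \1_(band n) z * z).
Proof.
under eq_fun do rewrite mulrC.
by apply: (bounded_borel_on (F := id) (c := n%:R)) => //; exact: cmeasurable_id.
Qed.

(** Second-order remainder of e^(hz) on the disc |z| <= n, the symbol of T h - I - h A there. *)
Let exp_taylor n h z : R[i] :=
  (exp_fun A h z - \1_sA z - (h%:C * z) * \1_sA z) * \1_(band n) z.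

Let exp_taylor_le n h : 0 < h <= 1 ->
  bounded_by (exp_taylor n h) (4 * (h * n%:R) ^+ 2 * expR n%:R).
Proof.
move=> /andP[h0 h1]; have c0 : 0 <= 4 * (h * n%:R) ^+ 2 * expR n%:R.
  by rewrite mulr_ge0 ?expR_ge0// mulr_ge0// sqr_ge0.
apply: bounded_by_indicP => // z zn.
rewrite /exp_fun -[X in _ - X - _]mul1r -!mulrBl rnormM.
rewrite (le_trans (ler_piMr (rnorm_ge0 _) (rnorm_indic_le1 _ _)))//.
have hz : h * rnorm z <= n%:R.
  by rewrite (le_trans _ zn)// ler_piMl ?rnorm_ge0.
have := @rnorm_cexpB1B _ (h%:C * z) n%:R; rewrite scaleC_rnorm ?(ltW h0)//.
move=> /(_ hz)/le_trans; apply; rewrite ler_wpM2r ?expR_ge0// ler_wpM2l//.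
by rewrite ler_pXn2r ?nnegrE ?mulr_ge0 ?rnorm_ge0 ?(ltW h0)// ler_wpM2l// ltW.
Qed.

Let bounded_borel_exp_taylor n h : 0 < h <= 1 -> bounded_borel (exp_taylor n h).
Proof.
move=> h01; split; last by exists (4 * (h * n%:R) ^+ 2 * expR n%:R); exact: exp_taylor_le.
apply: cmeasurableM; last exact: cmeasurable_indic.
have mI := cmeasurable_indic bs.
have mN (F : R[i] -> R[i]) : cmeasurable F -> cmeasurable (fun z => - F z).
  move=> mF; under eq_fun do rewrite -mulN1r.
  by apply: cmeasurableM => //; exact: cmeasurable_cst.
apply: cmeasurableD; first apply: cmeasurableD.
- exact: (cmeasurable_exp_fun hA).
- exact: mN.
- apply: mN; apply: cmeasurableM => //; apply: cmeasurableM.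
    exact: cmeasurable_cst.
  exact: cmeasurable_id.
Qed.

Let exp_taylor_integral n h f : 0 < h <= 1 ->
  bounded_integral E (exp_taylor n h) f = T h (E (band n) f) - E (band n) f -
    h%:C *: bounded_integral E (fun z => \1_(band n) z * z) f.
Proof.
move=> h01; have /andP[/ltW h0 _] := h01.
have bI := bounded_borel_indic (borel_band n).
have be := bounded_borel_exp_fun hA hw h0.
have beI := bounded_borelM be bI.
have bz := bounded_borel_band_id n.
rewrite /exp_semigroup -(bounded_integral_indic hE)// -(bounded_integralM hE)//.
rewrite -(bounded_integralB hE)// addrC -scaleNr -(bounded_integral_linear hE)//;
  last exact: bounded_borelB.
have bD : bounded_borel (fun z => - h%:C * (\1_(band n) z * z) +
    (exp_fun A h z * \1_(band n) z - \1_(band n) z)).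
  split; last first.
    have [[_ [c hc]] [_ [c' hc']]] := (bz, bounded_borelB beI bI).
    exists (rnorm (- h%:C : R[i]) * c + c') => z.
    by rewrite (le_trans (rnormD _ _))// lerD// rnormM ler_wpM2l ?rnorm_ge0.
  apply: cmeasurableD; last by case: (bounded_borelB beI bI).
  by apply: cmeasurableM; [exact: cmeasurable_cst|case: bz].
(* Every term of the remainder carries the indicator of the spectrum; it is inserted at no cost
   since E(spectrum) = I. *)
rewrite -(bounded_integral_spectrum hA _ bD).
congr (bounded_integral E _ f); apply/funext => z.
rewrite /exp_taylor -[in RHS]/(exp_fun A h z).
have es : exp_fun A h z = exp_fun A h z * \1_sA z.
  rewrite /exp_fun -mulrA; congr (_ * _).
  by rewrite -[in LHS](setIid (spectrum A)) indicI.
rewrite [in LHS]es; ring.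
Qed.

(* Both semigroups agree with u + h A u up to an error of order e h, where
   u = T' s f. *)
Let step_bound n t f (K M : R) : 0 <= t -> dom A f ->
  0 < K -> (forall F c g, bounded_borel F -> 0 <= c -> bounded_by F c ->
    rnorm (bounded_integral E F g) <= K * c * rnorm g) ->
  0 < M -> (forall s g, 0 <= s <= t -> rnorm (T' s g) <= M * rnorm g) ->
  forall e h s, 0 < e -> 0 < h <= 1 -> h <= e -> 0 <= s -> s + h <= t ->
  rnorm (diff_quotient T' f h - A f) <= e ->
  rnorm (E (band n) (T' (s + h) f) - T h (E (band n) (T' s f))) <=
    (K * M + K * (4 * n%:R ^+ 2 * expR n%:R) * (M * rnorm f)) * e * h.
Proof.
move=> t0 df K0 hK M0 hM e h s e0 h01 he s0 sht hq.
have /andP[h0 h1] := h01; have st : 0 <= s <= t by rewrite s0/=; lra.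
have [du Au] := generator_invariant hT' gT'.2 s0 df.
set u := T' s f in du Au *.
have bI := bounded_borel_indic (borel_band n).
(* Rewrites the first-order term of T' as the one subtracted in the Taylor remainder of T, so that
   the two cancel. *)
have EA : E (band n) (T' s (A f)) =
    bounded_integral E (fun z => \1_(band n) z * z) u.
  rewrite -Au -(bounded_integral_indic hE)//.
  by rewrite (scalar_integrates hA du bI (bounded_borel_band_id n)).
have -> : E (band n) (T' (s + h) f) - T h (E (band n) u) =
    E (band n) (T' s (h%:C *: (diff_quotient T' f h - A f))) -
    bounded_integral E (exp_taylor n h) u.
  have -> : T' s (h%:C *: (diff_quotient T' f h - A f)) =
      T' (s + h) f - u - h%:C *: T' s (A f).
    rewrite scalerBr /diff_quotient scalerA -rmorphM mulfV ?gt_eqF// scale1r.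
    by rewrite 2!linearB/= linearZ/= -(C0_add hT') ?(ltW h0).
  rewrite exp_taylor_integral// -EA.
  have -> : E (band n) (T' (s + h) f - u - h%:C *: T' s (A f)) =
      E (band n) (T' (s + h) f) - E (band n) u - h%:C *: E (band n) (T' s (A f)).
    by rewrite 2!linearB/= linearZ.
  set a := E _ (T' (s + h) f); set b := E _ u; set c := _ *: _; set p := T h b.
  by rewrite -[a - b - c]addrA -[p - b - c]addrA -opprD opprB addrA subrK.
rewrite [leRHS](_ : _ = K * M * e * h +
  K * (4 * n%:R ^+ 2 * expR n%:R) * (M * rnorm f) * e * h); last by ring.
rewrite (le_trans (rnormB _ _))// lerD//.
  rewrite -(bounded_integral_indic hE)//.
  apply: (le_trans (hK _ 1 _ bI ler01 (rnorm_indic_le1 _))).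
  rewrite mulr1 -!mulrA ler_pM2l// (le_trans (hM _ _ st))// ler_pM2l//.
  by rewrite rnormZ rnormC gtr0_norm// mulrC ler_wpM2r// ltW.
have c0 : 0 <= 4 * (h * n%:R) ^+ 2 * expR n%:R :> R.
  by rewrite mulr_ge0 ?expR_ge0// mulr_ge0// sqr_ge0.
have hb := hK _ _ u (bounded_borel_exp_taylor n h01) c0 (exp_taylor_le n h01).
apply: (le_trans hb).
apply: (@le_trans _ _ (K * (4 * (h * n%:R) ^+ 2 * expR n%:R) * (M * rnorm f))).
  by rewrite ler_wpM2l ?hM// mulr_ge0// ltW.
rewrite [leLHS](_ : _ = (K * (4 * n%:R ^+ 2 * expR n%:R) * (M * rnorm f)) * h * h);
  last by ring.
rewrite ler_wpM2r ?(ltW h0)// ler_wpM2l//.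
by rewrite !mulr_ge0 ?expR_ge0 ?rnorm_ge0 ?sqr_ge0// ltW.
Qed.

Let band_unique n t f : 0 < t -> dom A f ->
  E (band n) (T' t f) = E (band n) (T t f).
Proof.
move=> t0 df; have [K K0 hK] := bounded_integral_le hE.
have [M M0 hM] := C0_locally_bounded hT' t.
have [K' K'0 hK'] := C0_locally_bounded hT t.
set C := K * M + K * (4 * n%:R ^+ 2 * expR n%:R) * (M * rnorm f).
have C0 : 0 <= C.
  by rewrite addr_ge0// !mulr_ge0 ?expR_ge0 ?rnorm_ge0// ltW.
apply: (@eq_rnorm_small _ _ _ _ (t * (K' * C))) => [|e e0].
  by rewrite !mulr_ge0// ltW.
have /cvg_rnormP/(_ _ e0)/near_right0P[d d0 hd] := generator_cvg gT'.2 df.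
(* Steps below d bring the difference quotient within e of A f, steps up to e make the quadratic
   error of order e h, and 1 is the range of the Taylor bound. *)
pose m : R := Num.min (d / 2) (Num.min e 1).
have m0 : 0 < m by rewrite !lt_min divr_gt0// e0 ltr01.
pose N := (Num.truncn (t / m)).+1; pose h := t / N%:R.
have h0 : 0 < h by rewrite divr_gt0.
have hm : h <= m.
  rewrite ler_pdivrMr// mulrC -ler_pdivrMr// ltW//; exact: truncnS_gt.
have hd2 : h < d.
  apply: (@le_lt_trans _ _ (d / 2)); last by lra.
  by rewrite (le_trans hm)// ge_min lexx.
have he : h <= e by rewrite (le_trans hm)// !ge_min lexx orbT.
have h1 : h <= 1 by rewrite (le_trans hm)// !ge_min lexx !orbT.
have h01 : 0 < h <= 1 by rewrite h0 h1.
have Nh : N%:R * h = t by rewrite mulrC divfK ?pnatr_eq0.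
(* Interpolates between T t and T' t, replacing one step of length h at a
   time. *)
pose G k := T (t - k%:R * h) (E (band n) (T' (k%:R * h) f)).
have GN : G N = E (band n) (T' t f).
  by rewrite /G Nh subrr (C0_zero hT).
have G0 : G 0%N = E (band n) (T t f).
  rewrite /G mul0r subr0 (C0_zero hT') /exp_semigroup.
  have bI := bounded_borel_indic (borel_band n).
  rewrite -!(bounded_integral_indic hE)// (bounded_integralC hE)//.
  by apply: (bounded_borel_exp_fun hA hw); exact: ltW.
rewrite -GN -G0 -(telescope_sumr _ (leq0n N)) big_mkord.
apply: le_trans (rnorm_sum _ _ _) _.
apply: (@le_trans _ _ (\sum_(k < N) (K' * (C * e * h)))); last first.
  rewrite sumr_const card_ord -mulr_natl -Nh le_eqVlt; apply/orP; left.
  by apply/eqP; ring.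
apply: ler_sum => k _.
have kN : k.+1%:R * h <= t by rewrite -Nh ler_pM2r// ler_nat ltn_ord.
have skh : k.+1%:R * h = k%:R * h + h by rewrite -natr1 mulrDl mul1r.
have -> : G k.+1 - G k = T (t - k.+1%:R * h)
    (E (band n) (T' (k%:R * h + h) f) - T h (E (band n) (T' (k%:R * h) f))).
  rewrite linearB/= -(C0_add hT) ?subr_ge0 ?(ltW h0)// -skh /G.
  by congr (_ - T _ _); rewrite skh; ring.
apply: (le_trans (hK' _ _ _)).
  by rewrite subr_ge0 kN/= gerBl mulr_ge0// ltW.
rewrite ler_pM2l//.
apply: (@step_bound n t f K M (ltW t0) df K0 hK M0 hM e h _ e0 h01 he).
- by rewrite mulr_ge0// ltW.
- by rewrite -skh.
- by apply: hd; rewrite h0 hd2.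
Qed.

Let dom_unique t f : 0 < t -> dom A f -> T' t f = T t f.
Proof.
move=> t0 df; have h1 := @spectral_rnorm_le_cvg _ _ _ hE id (T' t f) (@cmeasurable_id R).
have h2 := @spectral_rnorm_le_cvg _ _ _ hE id (T t f) (@cmeasurable_id R).
apply: (cvg_unique _ h1); first exact: norm_hausdorff.
by apply: cvg_trans h2; apply: near_eq_cvg; near=> n; rewrite -band_unique.
Unshelve. all: by end_near. Qed.

Lemma dom_spectral_band n f : dom A (E (band n) f).
Proof.
have bI := bounded_borel_indic (borel_band n).
suff [] : dom A (E (band n) f) /\ A (E (band n) f) =
  bounded_integral E (fun z => \1_(band n) z * z) f by [].
apply: (integrates_scalar hA) => H bH bHz.
rewrite -(bounded_integral_indic hE)// -!(bounded_integralM hE)//.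
by congr (bounded_integral E _ f); apply/funext => z; ring.
Qed.

(** Both operators are continuous and agree on the vectors E (band n) f, which lie in the domain of
    A and tend to f. *)
Lemma exp_semigroup_unique t f : 0 <= t -> T' t f = T t f.
Proof.
rewrite le_eqVlt => /orP[/eqP <-|t0]; first by rewrite (C0_zero hT) (C0_zero hT').
have h := @spectral_rnorm_le_cvg _ _ _ hE id f (@cmeasurable_id R).
have h1 : T' t (E (band n) f) @[n --> \oo] --> T' t f.
  by apply: (cvg_comp _ _ h); apply: (C0_bounded hT'); exact: ltW.
have h2 : T t (E (band n) f) @[n --> \oo] --> T t f.
  by apply: (cvg_comp _ _ h); apply: (C0_bounded hT); exact: ltW.
apply: (cvg_unique _ h1); first exact: norm_hausdorff.
apply: cvg_trans h2; apply: near_eq_cvg; near=> n.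
by rewrite dom_unique//; exact: dom_spectral_band.
Unshelve. all: by end_near. Qed.

End Uniqueness.

Theorem theorem3p1 (R : realType) (X : completeNormedModType R[i])
    (A : linear_op X) (E : set R[i] -> {linear X -> X})
    (hA : scalar_type_spectral A E) :
  [/\ ~ hypercyclic A,
      ~ hypercyclic_family [set t : R | 0 <= t] (exp_op A E) &
      forall w : R,
        spectrum A `<=` [set l | complex.Re l <= w] ->
        exists T : R -> {linear X -> X},
          [/\ generates T A,
              forall T' : R -> {linear X -> X}, generates T' A ->
                forall t : R, 0 <= t -> forall f : X, T' t f = T t f &
              forall t : R, 0 <= t -> op_eq (exp_op A E t) (total_op (T t))]].
Proof.
split=> [||w hw].
- exact: scalar_type_not_hypercyclic hA.
- exact: exp_not_hypercyclic.
- exists (exp_semigroup A E); split.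
  + exact: (exp_semigroup_generates hA hw).
  + by move=> T' gT' t t0 f; exact: (exp_semigroup_unique hA hw gT').
  + by move=> t t0; exact: (exp_op_semigroup hA hw).
Qed.
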